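(* In the risk model below, suppose Assumption A1 holds and $B_0\in\mathcal S$. Then $$\lim_{u\to\infty}\frac{\psi(u)}{\overline B_0(u)}=\frac{\rho}{1-\rho}.$$
   Context: Risk model: $U_t=u+pt-\sum_{i=1}^{N_t}C_i$ with initial reserve $u>0$, premium rate $p>0$, $C_i$ i.i.d. nonnegative claims with distribution function $B$ and $\mathbb{E}[C_1]<\infty$, independent of the simple point process $N_t$ ($N_0=0$) with arrival times $\tau_i$ and inter-arrival times $T_i=\tau_i-\tau_{i-1}$, $\tau_0=0$. Ruin time $\tau_u:=\inf\{t>0:U_t\le0\}$, infinite-horizon ruin probability $\psi(u):=\mathbb{P}(\tau_u<\infty)$. $\overline F=1-F$; $B_0(x):=\frac{1}{\mathbb{E}[C_1]}\int_0^x\overline B(y)\,dy$. $\mathcal S$ is the class of subexponential distribution functions $F$ on $[0,\infty)$: $\mathbb{P}(X_1+X_2>x)/\mathbb{P}(X_1>x)\to2$ for $X_1,X_2$ i.i.d. $\sim F$. Assumption A1: (i) $(N_t/t\in\cdot)$ satisfies a large deviation principle with rate function $I$ such that $I(x)=0$ iff $x=\mu$; (ii) $I$ is increasing on $[\mu,\infty)$ and decreasing on $[0,\mu]$; (iii) $\rho:=\mu\mathbb{E}[C_1]/p<1$; (iv) there is $\theta>0$ with $\mathbb{E}[e^{\theta\sum_{i=1}^nT_i}]<\infty$ for all $n\in\mathbb{N}$. *)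

(* Defs.v *)
From HB Require Import structures.
From mathcomp Require Import all_boot all_order all_algebra.
From mathcomp Require Import all_classical all_reals all_analysis.
Set Implicit Arguments. Unset Strict Implicit. Unset Printing Implicit Defensive.
Import Order.TTheory GRing.Theory Num.Theory.
Import numFieldNormedType.Exports.
Local Open Scope classical_set_scope.
Local Open Scope ring_scope.

Section defs.
Context {R : realType}.

Definition elog (x : \bar R) : \bar R :=
  match x with
  | r%:E => if r == 0 then -oo%E else (ln r)%:E
  | +oo%E => +oo%E
  | -oo%E => -oo%E
  end.

Definition rate_function (I : R -> \bar R) : Prop :=
  (forall x, (0 <= I x)%E) /\ lower_semicontinuous I.

Definition LDP {d} {T : measurableType d} (P : probability T R)
  (X : R -> T -> R) (I : R -> \bar R) : Prop :=
  rate_function I /\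
  (forall F : set R, closed F ->
     (limf_esup (fun t : R => (t^-1)%:E * elog (P (X t @^-1` F)))%E
                (pinfty_nbhs R)
      <= - ereal_inf (I @` F))%E) /\
  (forall G : set R, open G ->
     (- ereal_inf (I @` G)
      <= limf_einf (fun t : R => (t^-1)%:E * elog (P (X t @^-1` G)))%E
                   (pinfty_nbhs R))%E).

(* the claims C_0, C_1, ... are mutually independent and the family of claims
   is independent of the arrival-time process (tau_j)_j  (finite-dimensional
   formulation) *)
Definition claims_indep {d} {T : measurableType d} (P : probability T R)
  (C tau : nat -> T -> R) : Prop :=
  forall (n m : nat) (A D : nat -> set R),
    (forall i, measurable (A i)) -> (forall j, measurable (D j)) ->
    P (\bigcap_(i in `I_n) (C i @^-1` A i) `&` \bigcap_(j in `I_m) (tau j @^-1` D j))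
    = ((\prod_(i < n) P (C i @^-1` A i)) * P (\bigcap_(j in `I_m) (tau j @^-1` D j)))%E.

Definition distribution_function_nonneg (F : R -> R) : Prop :=
  nondecreasing F /\ (forall x, F%function @ at_right x --> F x) /\
  (forall x, x < 0 -> F x = 0) /\ F%function @ +oo --> (1 : R).

Definition subexponential (F : R -> R) : Prop :=
  distribution_function_nonneg F /\
  forall d (T : measurableType d) (Q : probability T R) (X1 X2 : {RV Q >-> R}),
    (forall x, Q [set w | X1 w <= x] = (F x)%:E) ->
    (forall x, Q [set w | X2 w <= x] = (F x)%:E) ->
    (forall A B : set R, measurable A -> measurable B ->
       Q (X1 @^-1` A `&` X2 @^-1` B) = (Q (X1 @^-1` A) * Q (X2 @^-1` B))%E) ->
    (fine (Q [set w | X1 w + X2 w > x]) / fine (Q [set w | X1 w > x]))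
      @[x --> +oo] --> (2 : R).

(* surplus process U_t = u + p t - sum_{i=1}^{N_t} C_i  (claims 0-indexed) *)
Definition surplus {T : Type} (p u : R) (C : nat -> T -> R) (N : R -> T -> nat)
  (t : R) (w : T) : R :=
  u + p * t - \sum_(i < N t w) C i w.

Definition ruin_event {T : Type} (p u : R) (C : nat -> T -> R)
  (N : R -> T -> nat) : set T :=
  [set w | exists t, 0 < t /\ surplus p u C N t w <= 0].

Definition integrated_tail (EC : R) (B : R -> R) (x : R) : R :=
  EC^-1 * fine (\int[lebesgue_measure]_(y in `[0%R, x]%classic) (1 - B y)%:E)%E.

End defs.

(* Main.v *)
Require Import Defs.
From HB Require Import structures.
From mathcomp Require Import all_boot all_order all_algebra.
From mathcomp Require Import all_classical all_reals all_analysis.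
From mathcomp Require Import measurable_realfun ring lra zify.
Import Order.TTheory GRing.Theory Num.Theory.
Import numFieldNormedType.Exports.
Set Implicit Arguments. Unset Strict Implicit. Unset Printing Implicit Defensive.
Local Open Scope classical_set_scope.
Local Open Scope ring_scope.

(** Let [m] be the mean claim size and [G = 1 - B_0].  Ruin means that the claim
    sums [S_n] exceed [u + p tau_n] for some [n].

    Upper bound.  For [nu > mu] the LDP makes [sup_n (n / nu - tau_n)] a variable
    with exponential tails, independent of the claims, so that by long-tailedness
    of [G] it suffices to bound the probability that [S_n >= u + n a] for some [n],
    where [a = p / nu].  Rounding the claims up to a lattice of mesh [h = a / b] and
    replacing the deterministic premium of [b] lattice units per claim by a
    geometric number of units of slightly smaller mean turns the walk into one that
    is skip-free downwards; its ruin function is dominated by the tail of a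
    geometric compound whose ladder-height law is a lattice version of [B_0], and
    that tail is asymptotic to a constant multiple of [G] by subexponentiality.
    The geometric clock stays close to its linear drift with probability near [1],
    uniformly in time, which transfers the bound to the deterministic premium.  All
    walk estimates are inductions on the number of remaining claims, relative to an
    event independent of these claims.

    Lower bound.  For [nu < mu] and [b < m], with probability near [1] uniformly in
    [n] one has [S_n >= n b - A'] and [tau_n <= n / nu + A]; then a single claim
    [C_n > u + A'' + n (p / nu - b)] causes ruin.  Summing over [n] yields nearly
    [m / (p / nu - b) * G u], and the overlaps are of order [G u ^ 2]. *)

(** * Recursion on the list of all earlier values *)

Section strong_recursion.
Context {V : Type} (x0 : V) (rec : seq V -> V).

Fixpoint recseq n : seq V :=
  if n is n'.+1 then rcons (recseq n') (rec (recseq n')) else [::].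

Lemma size_recseq n : size (recseq n) = n.
Proof. by elim: n => //= n IH; rewrite size_rcons IH. Qed.

Lemma recseq_mkseq n : recseq n = mkseq (fun i => rec (recseq i)) n.
Proof. by elim: n => //= n IH; rewrite mkseqS -IH. Qed.

End strong_recursion.

(** * Mass function and tail of a geometric compound *)

Section defective_renewal.
Context {R : realType}.
Implicit Types (q k : R) (G d g : nat -> R).

Lemma renewal_exists (c : R) (a : nat -> R) : exists d : nat -> R,
  d 0%N = c /\ forall n, d n.+1 = \sum_(i < n.+1) a i * d (n - i)%N.
Proof.
(* The list [s] holds [d 0, ..., d n]. The index [n - i] is always in range, so the default [0] of
   [nth] is never read. *)
pose rec (s : seq R) :=
  if size s is n.+1 then \sum_(i < n.+1) a i * nth 0 s (n - i) else c.
exists (fun n => rec (recseq rec n)); split; first by [].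
move=> n; rewrite {1}/rec size_recseq; apply: eq_bigr => i _.
by rewrite recseq_mkseq nth_mkseq // ltnS leq_subr.
Qed.

Lemma renewal_ge0 (c : R) (a d : nat -> R) : 0 <= c -> (forall i, 0 <= a i) ->
  d 0%N = c -> (forall n, d n.+1 = \sum_(i < n.+1) a i * d (n - i)%N) ->
  forall n, 0 <= d n.
Proof.
move=> c0 a0 d0 dS n; have [m] := ubnP n; elim: m n => // m IH [|n].
  by rewrite d0.
rewrite ltnS => nm; rewrite dS; apply: sumr_ge0 => i _.
by rewrite mulr_ge0 // IH // (leq_ltn_trans (leq_subr _ _)).
Qed.

(* [g] is the tail of the geometric compound with ladder-height law
   [q, k (G 0 - G 1), k (G 1 - G 2), ...] on the naturals, of total mass [q + k < 1] *)
Lemma compound_tail_exists q k G : 0 <= q -> 0 <= k -> q + k < 1 ->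
  (forall i, G i.+1 <= G i) -> (forall i, 0 <= G i) -> G 0%N = 1 ->
  exists g : nat -> R, [/\ g 0%N = 1, (forall i, g i.+1 <= g i),
    (forall n, 0 <= g n),
    (forall n, (1 - q) * (g n.+1 - g n.+2) =
       \sum_(i < n.+1) k * (G i - G i.+1) * (g (n - i)%N - g (n - i).+1)) &
    (forall n, (1 - q) * g n.+1 =
       k * G n + \sum_(i < n) k * (G i - G i.+1) * g (n - i)%N)].
Proof.
move=> q0 k0 qk1 Gd G0 G01.
have q1 : 0 < 1 - q by lra.
pose f i := k * (G i - G i.+1).
have f0 i : 0 <= f i by rewrite mulr_ge0 // subr_ge0.
(* [d] is the mass function of the compound: [f i] is the probability of a ladder height [i + 1],
   and the null heights, of probability [q], are absorbed in the division by [1 - q]. *)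
have [d [d0 dS]] := renewal_exists ((1 - (q + k)) / (1 - q))
  (fun i => f i / (1 - q)).
have dge0 : forall n, 0 <= d n.
  have c0 : 0 <= (1 - (q + k)) / (1 - q) by rewrite divr_ge0 ?ltW //; lra.
  have a0 i : 0 <= f i / (1 - q) by rewrite divr_ge0 // ltW.
  exact: (renewal_ge0 c0 a0 d0 dS).
have dS' n : (1 - q) * d n.+1 = \sum_(i < n.+1) f i * d (n - i)%N.
  rewrite dS mulr_sumr; apply: eq_bigr => i _; field; lra.
pose g n := 1 - \sum_(i < n) d i.
have gd n : g n - g n.+1 = d n by rewrite /g big_ord_recr /=; ring.
have g01 : g 0%N = 1 by rewrite /g big_ord0 subr0.
have geq n : (1 - q) * g n.+1 = k * G n + \sum_(i < n) f i * g (n - i)%N.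
  elim: n => [|n IH].
    rewrite big_ord0 addr0 G01 /g big_ord_recr big_ord0 /= d0; field; lra.
  have -> : (1 - q) * g n.+2 = (1 - q) * g n.+1 - (1 - q) * d n.+1.
    by rewrite -gd; ring.
  rewrite IH dS' !big_ord_recr /= subnn subSn // subnn /= .
  have -> : \sum_(i < n) f i * g (n.+1 - i)%N =
    \sum_(i < n) f i * g (n - i)%N - \sum_(i < n) f i * d (n - i)%N.
    rewrite -sumrB; apply: eq_bigr => i _.
    by rewrite -gd subSn; [ring|exact: ltnW].
  rewrite -(gd 0%N) g01 /f; ring.
exists g; split => //.
- by move=> i; rewrite -subr_ge0 gd.
(* The definition of [g] as [1] minus a partial sum gives no sign; the renewal equation [geq], whose
   terms are all nonnegative, does. *)
- elim/ltn_ind => -[|n IH]; first by rewrite g01.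
  rewrite -(pmulr_rge0 _ q1) geq addr_ge0 ?mulr_ge0 //.
  apply: sumr_ge0 => i _; rewrite mulr_ge0 // IH //.
  by rewrite ltnS leq_subr.
- by move=> n; rewrite gd dS'; apply: eq_bigr => i _; rewrite gd.
Qed.

End defective_renewal.

(** * Comparison of the compound tail with the ladder-height tail *)

Section compound_asymptotics.
Context {R : realType} (q k : R) (G r : nat -> R).
Hypotheses (k0 : 0 < k) (qk1 : q + k < 1).
Hypotheses (Gd : forall i, G i.+1 <= G i) (G0 : forall i, 0 < G i).
Hypothesis G_long : forall (m : nat) (e : R), 0 < e ->
  exists n0, forall n, (n0 <= n)%N -> G (n - m)%N <= (1 + e) * G n.
Hypothesis G_sub : forall e : R, 0 < e ->
  exists n0, forall n, (n0 <= n)%N ->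
    \sum_(i < n) (G i - G i.+1) * G (n.-1 - i)%N <= (1 + e) * G n.
Hypothesis r1 : forall n, r n <= 1.
Hypothesis rE : forall n,
  (1 - q) * r n = k * G n + \sum_(i < n) k * (G i - G i.+1) * r (n.-1 - i)%N.

Let Gnd : forall i j, (i <= j)%N -> G j <= G i.
Proof.
move=> i j /subnK <-; elim: (j - i)%N => [|m IH] //=; rewrite ?add0n //.
by rewrite addSn (le_trans (Gd _)).
Qed.

(** If [r <= D G] below [n], the renewal equation gives [(1 - q) r n <= (k + k D (1 + e)) G n],
    which closes the induction when [k <= D (1 - q - k (1 + e))]. The choice of [e] makes the
    bracket half of [1 - q - k]. The summand [1 / G n0] of [D] covers [n <= n0], where only [r <= 1]
    is available. *)
Lemma compound_bounded : exists2 D : R, 0 < D & forall n, r n <= D * G n.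
Proof.
have [h1 h2] := (k0, qk1).
pose e := (1 - q - k) / (2 * k).
have e0 : 0 < e by apply: divr_gt0; [lra | rewrite mulr_gt0].
have ke : k * e = (1 - q - k) / 2 by rewrite /e; field; lra.
have [n0 Hn0] := G_sub e0.
pose D := (G n0)^-1 + k / (1 - q - k * (1 + e)).
have D2 : 0 < 1 - q - k * (1 + e) by rewrite mulrDr ke; lra.
have D1 : 0 < k / (1 - q - k * (1 + e)) by rewrite divr_gt0.
have D3 : 0 < (G n0)^-1 by rewrite invr_gt0.
have D0 : 0 < D by rewrite addr_gt0.
exists D => //; elim/ltn_ind => n IH.
have [nn0|nn0] := leqP n n0.
  apply: (le_trans (r1 n)); apply: (@le_trans _ _ ((G n0)^-1 * G n)).
    by rewrite ler_pdivlMl // mulr1 Gnd.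
  by rewrite ler_wpM2r ?(ltW (G0 _)) // /D lerDl ltW.
have q1 : 0 < 1 - q by lra.
rewrite -(ler_pM2l q1) rE.
have : \sum_(i < n) k * (G i - G i.+1) * r (n.-1 - i)%N <=
   k * D * \sum_(i < n) (G i - G i.+1) * G (n.-1 - i)%N.
  rewrite mulr_sumr; apply: ler_sum => i _.
  have -> : k * D * ((G i - G i.+1) * G (n.-1 - i)%N) =
    k * (G i - G i.+1) * (D * G (n.-1 - i)%N) by ring.
  apply: ler_wpM2l; first by rewrite mulr_ge0 ?subr_ge0 // ltW.
  by apply: IH; have := ltn_ord i; lia.
have : k * D * \sum_(i < n) (G i - G i.+1) * G (n.-1 - i)%N <=
  k * D * ((1 + e) * G n).
  by apply: ler_wpM2l; [rewrite mulr_ge0 // ltW | exact: Hn0 (ltnW nn0)].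
have : k <= D * (1 - q - k * (1 + e)) by rewrite -ler_pdivrMr // /D lerDr ltW.
have := G0 n; move: (\sum_(i < n) _) (\sum_(i < n) _) => s1 s2 gn0 H1 H2 H3.
have : k * G n <= D * (1 - q - k * (1 + e)) * G n by rewrite ler_wpM2r // ltW.
nra.
Qed.

Let step D e : 0 < D -> 0 < e -> (exists n1, forall n, (n1 <= n)%N -> r n <= D * G n) ->
  exists n2, forall n, (n2 <= n)%N ->
    (1 - q) * r n <= (k + D * k + e) * G n.
Proof.
move=> D0 e0 [n1 Hn1]; have [h1 h2] := (k0, qk1).
pose e1 := e / (2 * k * D); pose e2 := e / (2 * k).
have e10 : 0 < e1 by rewrite divr_gt0 // !mulr_gt0.
have e20 : 0 < e2 by rewrite divr_gt0 // !mulr_gt0.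
have [n2 Hn2] := G_sub e10; have [n3 Hn3] := G_long n1 e20.
exists (n1 + n2 + n3)%N => n Hn; rewrite rE.
have H1 : \sum_(i < n) k * (G i - G i.+1) * r (n.-1 - i)%N <=
   k * D * (\sum_(i < n) (G i - G i.+1) * G (n.-1 - i)%N) +
   k * \sum_(i < n) (if (n - n1 <= i)%N then G i - G i.+1 else 0).
  rewrite 2!mulr_sumr -big_split; apply: ler_sum => i _ /=.
  have -> : k * D * ((G i - G i.+1) * G (n.-1 - i)%N) =
    k * (G i - G i.+1) * (D * G (n.-1 - i)%N) by ring.
  have kG : 0 <= k * (G i - G i.+1) by rewrite mulr_ge0 ?subr_ge0 // ltW.
  have [ni|ni] := leqP (n - n1)%N i.
    rewrite -[leRHS]addrC ler_wpDr ?mulr_ge0 ?(ltW D0) ?(ltW (G0 _)) ?subr_ge0 //.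
    by rewrite ltW.
    by rewrite -[leRHS]mulr1; apply: ler_wpM2l.
  rewrite mulr0 addr0; apply: ler_wpM2l => //; apply: Hn1.
  by have := ltn_ord i; lia.
have H2 : \sum_(i < n) (if (n - n1 <= i)%N then G i - G i.+1 else 0) =
    G (n - n1)%N - G n.
  rewrite -(big_mkord xpredT (fun i => if (n - n1 <= i)%N then G i - G i.+1 else 0)).
  rewrite (big_cat_nat (n := (n - n1)%N)) ?leq_subr //=.
  rewrite [X in X + _]big_nat_cond big1 ?add0r; last first.
    by move=> i /andP[/andP[_ H] _]; rewrite leqNgt H.
  rewrite -[RHS]opprB -telescope_sumr ?leq_subr // -sumrN.
  rewrite big_nat_cond [RHS]big_nat_cond; apply: eq_bigr => i /andP[/andP[-> _] _].
  by rewrite opprB.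
have H3 := Hn2 n ltac:(lia); have H4 := Hn3 n ltac:(lia).
rewrite H2 in H1.
apply: (@le_trans _ _ (k * G n + (k * D * ((1 + e1) * G n) + k * (e2 * G n)))).
  rewrite lerD2l; apply: (le_trans H1); apply: lerD.
    by apply: ler_wpM2l => //; rewrite mulr_ge0 // ltW.
  by apply: ler_wpM2l; [exact: ltW | lra].
have E1 : k * D * e1 = e / 2 by rewrite /e1; field; rewrite !gt_eqF.
have E2 : k * e2 = e / 2 by rewrite /e2; field; rewrite gt_eqF.
have -> : k * G n + (k * D * ((1 + e1) * G n) + k * (e2 * G n)) =
  (k + k * D + k * D * e1 + k * e2) * G n by ring.
by rewrite E1 E2 ler_wpM2r ?(ltW (G0 _)) //; lra.
Qed.

(** The map [D -> (k + D k) / (1 - q)] is a contraction with fixed point [k / (1 - q - k)], so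
    iterating [step] from the constant of [compound_bounded] reaches [c] in finitely many passes. *)
Lemma compound_asymptotics c : k / (1 - q - k) < c ->
  exists n0, forall n, (n0 <= n)%N -> r n <= c * G n.
Proof.
move=> kc; have [h1 h2] := (k0, qk1).
have qk : 0 < 1 - q - k by lra.
have q1 : 0 < 1 - q by lra.
have c0 : 0 < c by rewrite (lt_trans _ kc) // divr_gt0.
have [D0 D00 HD0] := compound_bounded.
(* For [D >= c] the exact gain [(1 - q) D - (k + D k)] is at least [2 eta]: one [eta] pays for the
   error of [step], the other is the progress of the pass. *)
pose eta := (c * (1 - q - k) - k) / 2.
have eta0 : 0 < eta by move: kc; rewrite ltr_pdivrMr // /eta; lra.
have H j : exists n0, forall n, (n0 <= n)%N ->
    r n <= Num.max c (D0 - j%:R * eta / (1 - q)) * G n.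
  elim: j => [|j IH].
    exists 0%N => n _; rewrite mul0r mul0r subr0.
    by rewrite (le_trans (HD0 n)) // ler_wpM2r ?(ltW (G0 _)) // le_max lexx orbT.
  set D := Num.max c _ in IH.
  have Dc : c <= D by rewrite /D le_max lexx.
  have DD0 : 0 < D by rewrite (lt_le_trans c0).
  have [n2 Hn2] := step DD0 eta0 IH.
  exists n2 => n /Hn2 Hn.
  have HD : k + D * k + eta <= (1 - q) * D - eta.
    suff : c * (1 - q - k) <= D * (1 - q - k) by rewrite /eta; lra.
    by rewrite ler_wpM2r // ltW.
  have {Hn} Hn : r n <= (D - eta / (1 - q)) * G n.
    rewrite -(ler_pM2l q1) (le_trans Hn) // mulrA ler_wpM2r ?(ltW (G0 _)) //.
    by rewrite (le_trans HD) // mulrBr mulrCA divff ?gt_eqF // mulr1.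
  apply: (le_trans Hn); rewrite ler_wpM2r ?(ltW (G0 _)) //.
  rewrite lerBlDr /D ge_max; apply/andP; split.
    by rewrite ler_wpDr ?le_max ?lexx // divr_ge0 // ltW.
  have -> : D0 - j%:R * eta / (1 - q) =
     D0 - j.+1%:R * eta / (1 - q) + eta / (1 - q).
    by rewrite -natr1; ring.
  by rewrite lerD2r le_max lexx orbT.
have [j Hj] : exists j : nat, D0 - j%:R * eta / (1 - q) <= c.
  exists (Num.bound (D0 * (1 - q) / eta)).
  suff : D0 <= (Num.bound (D0 * (1 - q) / eta))%:R * eta / (1 - q) by lra.
  rewrite ler_pdivlMr // -ler_pdivrMr //.
  by apply/ltW/archi_boundP; apply: divr_ge0; [apply: mulr_ge0|]; rewrite ltW.
have [n0 Hn0] := H j; exists n0 => n /Hn0.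
by rewrite (max_idPl Hj).
Qed.

End compound_asymptotics.

(** * The geometric clock and the superharmonicity of the compound tail *)

Section geometric_clock.
Context {R : realType}.
Implicit Types (q z : R) (g s : nat -> R).

(* [escape q b n y] is the probability that [E_1 + ... + E_l <= y + l b] for all
   [l <= n], where the [E_i] are independent geometric of parameter [q]. *)
Fixpoint escape q (b n y : nat) : R :=
  if n is n'.+1 then
    \sum_(e < y + b) q * (1 - q) ^+ e * escape q b n' ((y + b).-1 - e)
  else 1.

Lemma geometric_sum q n : \sum_(e < n) q * (1 - q) ^+ e = 1 - (1 - q) ^+ n.
Proof.
elim: n => [|n IH]; first by rewrite big_ord0 expr0 subrr.
by rewrite big_ord_recr /= IH exprS; ring.
Qed.

Lemma escape_ge0 q b n y : 0 <= q <= 1 -> 0 <= escape q b n y.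
Proof.
move=> /andP[q0 q1]; elim: n y => //= n IH y; apply: sumr_ge0 => e _.
by rewrite !mulr_ge0 // exprn_ge0 // subr_ge0.
Qed.

Lemma escape_le1 q b n y : 0 <= q <= 1 -> escape q b n y <= 1.
Proof.
move=> /andP[q0 q1]; elim: n y => //= n IH y.
apply: (@le_trans _ _ (\sum_(e < y + b) q * (1 - q) ^+ e)); last first.
  by rewrite geometric_sum lerBlDr lerDl exprn_ge0 // subr_ge0.
apply: ler_sum => e _; rewrite -[leRHS]mulr1 ler_wpM2l // mulr_ge0 //.
by rewrite exprn_ge0 // subr_ge0.
Qed.

(** A Lundberg bound. For [E] geometric on the positive integers, the last hypothesis says that
    [z ^ (b - E)] has mean at most [1], so [z] to the power of the reserve bounds the probability of
    exhausting it. *)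
Lemma escape_ge q z b n y : 0 < q <= 1 -> 1 - q < z -> z <= 1 ->
  q * z ^+ b <= z - (1 - q) -> 1 - z ^+ y <= escape q b n y.
Proof.
move=> /andP[q0 q1] qz z1 qzb.
have z0 : 0 < z by rewrite (le_lt_trans _ qz) // subr_ge0.
elim: n y => [|n IH] y /=; first by rewrite lerBlDr lerDl exprn_ge0 // ltW.
have r0 : 0 <= 1 - q by rewrite subr_ge0.
(* Exhaustion of the reserve [L], of probability [(1 - q) ^ L], is charged [1]; the right side is
   the full mean of [z ^ (L - E)]. *)
have key L : (1 - q) ^+ L + \sum_(e < L) q * (1 - q) ^+ e * z ^+ (L.-1 - e)
    <= q / (z - (1 - q)) * z ^+ L.
  have -> : \sum_(e < L) q * (1 - q) ^+ e * z ^+ (L.-1 - e) =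
      q / (z - (1 - q)) * (z ^+ L - (1 - q) ^+ L).
    rewrite subrXX mulrA divfK ?subr_eq0 ?gt_eqF // mulr_sumr.
    by apply: eq_bigr => e _; ring.
  suff : (1 - q) ^+ L <= q / (z - (1 - q)) * (1 - q) ^+ L by rewrite mulrBr; lra.
  rewrite ler_peMl ?exprn_ge0 // ler_pdivlMr ?mul1r ?subr_gt0 //; lra.
have key2 : q / (z - (1 - q)) * z ^+ (y + b) <= z ^+ y.
  rewrite exprD mulrCA ger_pMr ?exprn_gt0 // mulrAC ler_pdivrMr ?subr_gt0 //.
  by rewrite mul1r.
have : \sum_(e < y + b) q * (1 - q) ^+ e * (1 - z ^+ ((y + b).-1 - e)) <=
    \sum_(e < y + b) q * (1 - q) ^+ e * escape q b n ((y + b).-1 - e).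
  apply: ler_sum => e _; apply: ler_wpM2l; last exact: IH.
  by rewrite mulr_ge0 ?exprn_ge0 // ltW.
have -> : \sum_(e < y + b) q * (1 - q) ^+ e * (1 - z ^+ ((y + b).-1 - e)) =
   1 - (1 - q) ^+ (y + b) -
   \sum_(e < y + b) q * (1 - q) ^+ e * z ^+ ((y + b).-1 - e).
  by rewrite -geometric_sum -sumrB; apply: eq_bigr => e _; ring.
have := key (y + b)%N; lra.
Qed.

(** The hypothesis says that [b] exceeds the mean [1 / q] of a clock step. With [w = q - 1 / b] and
    [z = 1 / (1 + w)], Bernoulli's inequality gives [z ^ b <= 1 / (q b)], so
    [q z ^ b <= 1 / b = q - w], and [1 - z = z w <= w]. *)
Lemma escape_root q b : 0 < q < 1 -> 1 < q * b%:R ->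
  exists z, [/\ 1 - q < z, z < 1 & q * z ^+ b <= z - (1 - q)].
Proof.
move=> /andP[q0 q1] qb.
have b0 : 0 < b%:R :> R by rewrite -(pmulr_rgt0 _ q0); lra.
pose w := (q * b%:R - 1) / b%:R.
have w0 : 0 < w by rewrite divr_gt0 // subr_gt0.
have wb : w * b%:R = q * b%:R - 1 by rewrite divfK // gt_eqF.
pose z := (1 + w)^-1.
have z0 : 0 < z by rewrite invr_gt0; lra.
have zw : z * (1 + w) = 1 by rewrite /z mulVf // gt_eqF //; lra.
have bernoulli : 1 + b%:R * w <= (1 + w) ^+ b.
  elim: (b) => [|i IH]; first by rewrite expr0 mul0r addr0.
  rewrite exprS -natr1; have iw : 0 <= i%:R * w by rewrite mulr_ge0 // ltW.
  by move: w0 IH iw; clear; move: ((1 + w) ^+ i) (i%:R) => x y; nra.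
have zb : z ^+ b * (1 + b%:R * w) <= 1.
  have /(ler_wpM2l (ltW (exprn_gt0 b z0))) := bernoulli.
  by rewrite -exprMn zw expr1n.
have H : q * z ^+ b <= z - (1 - q).
  have D0 : 0 < 1 + b%:R * w by rewrite addr_gt0 // mulr_gt0.
  rewrite -(ler_pM2r D0) -mulrA.
  apply: (@le_trans _ _ q); first by rewrite ler_piMr // ltW.
  have -> : z - (1 - q) = q - z * w by lra.
  suff : z * w * (1 + b%:R * w) <= q * b%:R * w by lra.
  have -> : 1 + b%:R * w = q * b%:R by lra.
  have -> : z * w * (q * b%:R) = z * (q * b%:R * w) by ring.
  apply: ler_piMl; first exact: ltW (mulr_gt0 (mulr_gt0 q0 b0) w0).
  by rewrite /z invf_le1; lra.
exists z; split => //.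
- suff : 0 < q * z ^+ b by lra.
  by rewrite mulr_gt0 // exprn_gt0.
- by rewrite invf_lt1; lra.
Qed.

Lemma abel_sum s (a : nat -> R) n :
  \sum_(j < n) (s j - s j.+1) * a j + s n * a n =
  s 0%N * a 0%N + \sum_(j < n) s j.+1 * (a j.+1 - a j).
Proof.
elim: n => [|n IH]; first by rewrite !big_ord0 add0r addr0.
rewrite !big_ord_recr /= [RHS]addrA -IH; ring.
Qed.

(* [s j] stands for [P(X >= j)]; the left-hand sum is the mean of [g (m + E - X)]
   over [E <= Y] for an independent geometric [E]. *)
Lemma compound_tail_superharmonic q (f : nat -> R) s g (m Y L : nat) : 0 <= q <= 1 ->
  (forall i, g i.+1 <= g i) -> g 0%N = 1 -> (forall i, 0 <= g i) ->
  (forall n, (1 - q) * (g n.+1 - g n.+2) =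
     \sum_(i < n.+1) f i * (g (n - i)%N - g (n - i).+1)) ->
  s 0%N = 1 -> s 1%N <= 1 -> (forall i, q * s i.+2 <= f i) ->
  (0 < m)%N -> (m + Y <= L)%N ->
  \sum_(e < Y) q * (1 - q) ^+ e *
    (\sum_(j < L) (s j - s j.+1) * g ((m + e).+1 - j)%N + s L) <= g m.
Proof.
move=> /andP[q0 q1] gd g01 g0 gE s0 s1 sf.
pose br m L := \sum_(j < L) (s j - s j.+1) * g (m.+1 - j)%N + s L.
(* A single trial of the clock at level [n + 1]: the level rises by one, then with probability [q] a
   claim arrives. Summation by parts writes [br] with the tails [s], and [q s (i + 2) <= f i]
   compares it with the renewal equation. *)
have brE n K : (n.+1 < K)%N ->
    (1 - q) * g n.+2 + q * br n.+1 K <= g n.+1.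
  move=> nK; have -> : br n.+1 K = g n.+2 +
      \sum_(j < n.+2) s j.+1 * (g (n.+1 - j)%N - g (n.+1 - j).+1).
    have -> : br n.+1 K = \sum_(j < K) (s j - s j.+1) * g (n.+2 - j)%N +
       s K * g (n.+2 - K)%N.
      by rewrite /br (_ : (n.+2 - K = 0)%N) ?g01 ?mulr1 //; lia.
    rewrite (abel_sum s (fun j => g (n.+2 - j)%N)) s0 mul1r subn0; congr (_ + _).
    rewrite -(big_mkord xpredT (fun j => s j.+1 * (g (n.+2 - j.+1)%N - g (n.+2 - j)%N))).
    rewrite (big_cat_nat (n := n.+2)) //= [X in _ + X]big_nat_cond [X in _ + X]big1 ?addr0; last first.
      move=> i /andP[/andP[ni _] _].
      have -> : (n.+2 - i.+1 = 0)%N by lia.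
      have -> : (n.+2 - i = 0)%N by lia.
      by rewrite subrr mulr0.
    rewrite big_mkord; apply: eq_bigr => j _; rewrite subSS.
    by rewrite (_ : (n.+2 - j = (n.+1 - j).+1)%N) //; have := ltn_ord j; lia.
  rewrite big_ord_recl subn0 /=.
  have : \sum_(i < n.+1) q * (s i.+2 * (g (n - i)%N - g (n - i).+1)) <=
      (1 - q) * (g n.+1 - g n.+2).
    rewrite gE; apply: ler_sum => i _; rewrite mulrA ler_wpM2r //.
    by rewrite subr_ge0.
  rewrite -mulr_sumr.
  under [in X in _ -> X]eq_bigr => i _ do rewrite /bump /= add1n subSS.
  move: (\sum_(i < n.+1) _) => S HS.
  have : s 1%N * (g n.+1 - g n.+2) <= g n.+1 - g n.+2.
    by rewrite ler_piMl // subr_ge0.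
  move: (s 1%N * _) => S'; nra.
(* The first trial is split off: the level rises by one while [Y] falls by one, so [m + Y <= L]
   persists. *)
elim: Y m => [|Y IH] [|m] // _ mYL; first by rewrite big_ord0.
rewrite big_ord_recl expr0 mulr1 addn0.
have H1 := brE m L ltac:(lia).
have H2 := IH m.+2 isT ltac:(lia).
rewrite (le_trans _ H1) // addrC lerD //.
rewrite (le_trans _ (ler_wpM2l _ H2)) ?subr_ge0 // mulr_sumr.
rewrite le_eqVlt; apply/orP; left; apply/eqP; apply: eq_bigr => e _ /=.
rewrite /bump /= add1n addnS exprS addSn; ring.
Qed.

End geometric_clock.

(** * Crossing of a lattice boundary by the claim sums *)

Section walk.
Context {R : realType} {d : measure_display} {T : measurableType d}.
Variable P : probability T R.
Implicit Types (E F : set T) (C : nat -> {RV P >-> R}).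

Definition pr E : R := fine (P E).

Lemma prE E : measurable E -> P E = (pr E)%:E.
Proof. by move=> mE; rewrite /pr fineK // fin_num_measure. Qed.

Lemma pr_ge0 E : 0 <= pr E.
Proof. exact: fine_ge0. Qed.

Lemma pr_le1 E : measurable E -> pr E <= 1.
Proof. by move=> mE; rewrite -lee_fin -prE // probability_le1. Qed.

Lemma pr_set0 : pr set0 = 0.
Proof. by rewrite /pr measure0. Qed.

Lemma pr_setT : pr setT = 1.
Proof. by rewrite /pr probability_setT. Qed.

Lemma pr_sub E F : measurable E -> measurable F -> E `<=` F -> pr E <= pr F.
Proof. by move=> mE mF EF; rewrite -lee_fin -!prE // le_measure // inE. Qed.

Lemma pr_setU E F : measurable E -> measurable F -> pr (E `|` F) <= pr E + pr F.
Proof.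
move=> mE mF; rewrite -lee_fin EFinD -!prE //; last exact: measurableU.
exact: measureU2.
Qed.

Lemma pr_bigsetU (F : nat -> set T) n : (forall i, measurable (F i)) ->
  pr (\big[setU/set0]_(i < n) F i) <= \sum_(i < n) pr (F i).
Proof.
move=> mF; elim: n => [|n IH]; first by rewrite !big_ord0 pr_set0.
rewrite !big_ord_recr /= (le_trans (pr_setU _ _)) ?lerD2r //.
by apply: bigsetU_measurable.
Qed.

Lemma pr_setD E F : measurable E -> measurable F -> F `<=` E ->
  pr (E `\` F) = pr E - pr F.
Proof.
move=> mE mF FE; apply: EFin_inj; rewrite EFinB -!prE //; last exact: measurableD.
by rewrite measureD ?setIidr // (le_lt_trans (probability_le1 P mE)) // ltry.
Qed.

(** [E] stands for the past: an event jointly independent of the claims still to come. Carrying it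
    as an event lets inductions on the remaining claims proceed without conditional
    probabilities. *)
Definition indep_claims C (i N : nat) E := measurable E /\
  forall A : nat -> set R, (forall l, measurable (A l)) ->
    pr (E `&` \bigcap_(l in [set l | (i <= l < N)%N]) C l @^-1` A l) =
    pr E * \prod_(i <= l < N) pr (C l @^-1` A l).

Lemma measurable_RV (X : {RV P >-> R}) (A : set R) : measurable A ->
  measurable (X @^-1` A).
Proof. by move=> mA; rewrite -[X in measurable X]setTI; exact: measurable_funP. Qed.

Lemma indep_claims1 C i N E k (D : set R) : indep_claims C i N E ->
  (i <= k < N)%N -> measurable D ->
  pr (E `&` C k @^-1` D) = pr E * pr (C k @^-1` D).
Proof.
move=> [mE H] ik mD; pose A l := if l == k then D else setT.
have mA l : measurable (A l) by rewrite /A; case: ifP.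
have := H A mA; rewrite (bigD1_seq k) ?mem_index_iota ?iota_uniq //=.
rewrite {2}/A eqxx big1 ?mulr1 => [<-|l lk]; last first.
  by rewrite /A (negbTE lk) preimage_setT pr_setT.
congr (pr (_ `&` _)); apply/seteqP; split => [w wD l /= _|w /(_ k ik)].
  by rewrite /A; case: eqP => // ->.
by rewrite /A eqxx.
Qed.

(** Revealing the next claim moves its event from the future into the past; this is the induction
    step of all walk estimates. *)
Lemma indep_claimsS C i N E (D : set R) : indep_claims C i N E -> (i < N)%N ->
  measurable D -> indep_claims C i.+1 N (E `&` C i @^-1` D).
Proof.
move=> indE iN mD; have [mE H] := indE; split.
  by apply: measurableI => //; exact: measurable_RV.
move=> A mA; rewrite (indep_claims1 indE) ?leqnn //.
pose A' l := if l == i then D else A l.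
have mA' l : measurable (A' l) by rewrite /A'; case: ifP.
have := H A' mA'; rewrite big_ltn // {2}/A' eqxx mulrA.
rewrite (_ : \prod_(i.+1 <= l < N) pr (C l @^-1` A' l) =
   \prod_(i.+1 <= l < N) pr (C l @^-1` A l)); last first.
  by apply: eq_big_nat => l /andP[il _]; rewrite /A' gtn_eqF.
move=> <-; congr (pr _); rewrite -setIA; congr (_ `&` _).
apply/seteqP; split => w.
  move=> [wD wA] l /= /andP[il lN]; rewrite /A'; case: eqP => [->//|/eqP li].
  by apply: wA; rewrite /= lN andbT ltn_neqAle eq_sym li.
move=> wA; split; first by have := wA i; rewrite /= leqnn iN /A' eqxx => /(_ isT).
move=> l /= /andP[il lN]; have := wA l; rewrite /= lN (ltnW il) /A' gtn_eqF //.
exact.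
Qed.

Definition crossing C (h : R) (b i n k : nat) : set T :=
  \bigcup_(l in `I_n.+1)
    [set w | (k + l * b)%:R * h <= \sum_(i <= j < i + l) C j w].

Lemma measurable_sumC C i n : measurable_fun setT (fun w => \sum_(i <= j < n) C j w).
Proof. by apply: measurable_sum => j; exact: measurable_funP. Qed.

Lemma measurable_crossing C h b i n k : measurable (crossing C h b i n k).
Proof.
apply: bigcup_measurable => l _.
rewrite (_ : [set w | _] = setT `&`
   (fun w => \sum_(i <= j < i + l) C j w) @^-1` `[(k + l * b)%:R * h, +oo[).
  by apply: measurable_sumC.
by rewrite setTI; apply/seteqP; split => w /=; rewrite in_itv /= andbT.
Qed.

(* With [X = ceil (C / h)], [claim_bin h j] is the event [X = j] and [claim_tail h j],
   below, is [P(X >= j)]. *)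
Definition claim_bin (h : R) (j : nat) : set R :=
  if j is j'.+1 then `]j'%:R * h, j%:R * h]%classic else `]-oo, 0]%classic.

Lemma claim_bin_cover h n (x : R) : x <= n%:R * h ->
  exists2 j, (j < n.+1)%N & claim_bin h j x.
Proof.
elim: n => [|n IH]; first by exists 0%N => //=; rewrite in_itv /= -(mul0r h).
have [/IH[j jn jx] _|xn xn'] := leP x (n%:R * h).
  by exists j => //; exact: ltnW.
by exists n.+1 => //=; rewrite in_itv /= xn.
Qed.

Lemma claim_bin_le h j x : claim_bin h j x -> x <= j%:R * h.
Proof. by case: j => [|j] /=; rewrite in_itv /= ?mul0r // => /andP[]. Qed.

Lemma measurable_claim_bin h j : measurable (claim_bin h j).
Proof. by case: j => [|j]; exact: measurable_itv. Qed.

Variables (C : nat -> {RV P >-> R}) (B : R -> R).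
Hypothesis CB : forall i x, P [set w | C i w <= x] = (B x)%:E.

Lemma pr_claim_le i x : pr (C i @^-1` `]-oo, x]%classic) = B x.
Proof.
by rewrite /pr (_ : _ @^-1` _ = [set w | C i w <= x]) ?CB.
Qed.

Lemma pr_claim_gt i x : pr (C i @^-1` `]x, +oo[%classic) = 1 - B x.
Proof.
rewrite -(pr_claim_le i) -pr_setT -pr_setD //; last exact: measurable_RV.
congr pr; apply/seteqP; split => w /=; rewrite !in_itv /= andbT ltNge.
  by move=> /negP.
by move=> [_ /negP].
Qed.

Lemma claim_df_le x y : x <= y -> B x <= B y.
Proof.
move=> xy; rewrite -!(pr_claim_le 0); apply: pr_sub; try exact: measurable_RV.
by move=> w /=; rewrite !in_itv /= => /le_trans; exact.
Qed.

Lemma claim_df_ge0 x : 0 <= B x. Proof. by rewrite -(pr_claim_le 0) pr_ge0. Qed.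

Lemma claim_df_le1 x : B x <= 1.
Proof. by rewrite -(pr_claim_le 0) pr_le1 //; exact: measurable_RV. Qed.

Definition claim_tail (h : R) j := if j is j'.+1 then 1 - B (j'%:R * h) else 1.

Lemma pr_claim_bin h i j : 0 <= h ->
  pr (C i @^-1` claim_bin h j) = claim_tail h j - claim_tail h j.+1.
Proof.
move=> h0; case: j => [|j] /=; first by rewrite pr_claim_le mul0r; ring.
transitivity (B (j.+1%:R * h) - B (j%:R * h)); last by ring.
rewrite -!(pr_claim_le i) -pr_setD; try exact: measurable_RV.
  congr pr; apply/seteqP; split => w /=; rewrite !in_itv /= ltNge.
    by move=> /andP[/negP].
  by move=> [-> /negP ->].
move=> w /=; rewrite !in_itv /= => /le_trans; apply.
by rewrite ler_wpM2r // ler_nat.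
Qed.

(** Rounding the first claim up to [j h] can only favour crossing, and leaves the level [k + b - j].
    Since [k > 0], the crossing does not happen before the first claim. *)
Lemma crossing_step h b i n k w j : 0 < h -> (0 < k)%N -> (j <= k + b)%N ->
  crossing C h b i n.+1 k w -> C i w <= j%:R * h ->
  crossing C h b i.+1 n (k + b - j) w.
Proof.
move=> h0 k0 jk [[|l] ln] /=.
  rewrite addn0 mul0n addn0 big_geq // leNgt => /negP + _; case.
  by rewrite mulr_gt0 // ltr0n.
rewrite addnS big_ltn ?ltnS ?leq_addr // => H Cj; exists l => //=.
rewrite addSn -(lerD2l (j%:R * h)) -mulrDl -natrD.
have -> : (j + (k + b - j + l * b) = k + l.+1 * b)%N by lia.
by rewrite (le_trans H) // lerD2r.
Qed.

(* The independent clock enters only through [escape], which multiplies the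
   probability, so no enlargement of the probability space is needed.  As
   subtraction on [nat] is truncated and [g 0 = 1], levels below [0] count as
   crossed. *)
Lemma crossing_prob h q b g : 0 < h -> 0 <= q <= 1 -> g 0%N = 1 ->
  (forall n, 0 <= g n) ->
  (forall m Y L, (0 < m)%N -> (m + Y <= L)%N ->
    \sum_(e < Y) q * (1 - q) ^+ e *
     (\sum_(j < L) (claim_tail h j - claim_tail h j.+1) * g ((m + e).+1 - j)%N
       + claim_tail h L) <= g m) ->
  forall n i k y E, indep_claims C i (i + n) E ->
    escape q b n y * pr (E `&` crossing C h b i n k) <= g (k - y)%N * pr E.
Proof.
move=> h0 q01 g01 g0 gS n; have [q0 q1] := andP q01.
elim: n => [|n IH] i k y E indE; have mE := indE.1.
  have mEc : measurable (E `&` crossing C h b i 0 k).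
    by apply: measurableI => //; exact: measurable_crossing.
  case: k mEc => [|k] mEc; first by rewrite sub0n g01 mul1r mul1r pr_sub.
  rewrite (_ : E `&` _ = set0) ?pr_set0 ?mulr0 ?mulr_ge0 ?pr_ge0 //.
  apply/seteqP; split => // w [_ [[|l] //= _]].
  rewrite addn0 mul0n addn0 big_geq // leNgt => /negP; case.
  by rewrite mulr_gt0.
have mc n' k' : measurable (crossing C h b i n' k') by exact: measurable_crossing.
have [ky|yk] := leqP k y.
  rewrite (eqP (_ : (k - y == 0)%N)) // g01 mul1r -[leRHS]mul1r.
  apply: ler_pM; rewrite ?escape_ge0 ?escape_le1 ?pr_ge0 //.
  by apply: pr_sub => //; exact: measurableI.
have k0 : (0 < k)%N by exact: leq_ltn_trans yk.
pose L := (k + b)%N; pose F j := E `&` C i @^-1` claim_bin h j.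
have iN : (i < i + n.+1)%N by lia.
have mF j : measurable (F j).
  by apply: measurableI => //; apply: measurable_RV; exact: measurable_claim_bin.
(* Such claims round up to at least [L = k + b] units and are counted as crossing at once. *)
pose H := E `&` C i @^-1` `]L.-1%:R * h, +oo[%classic.
have mH : measurable H by apply: measurableI => //; exact: measurable_RV.
have HF j : indep_claims C i.+1 (i.+1 + n) (F j).
  rewrite addSnnS; apply: indep_claimsS => //; exact: measurable_claim_bin.
have mFc j : measurable (F j `&` crossing C h b i.+1 n (L - j)).
  by apply: measurableI => //; exact: measurable_crossing.
have prF j : pr (F j) = pr E * (claim_tail h j - claim_tail h j.+1).
  rewrite (indep_claims1 indE) ?leqnn //; last exact: measurable_claim_bin.
  by rewrite pr_claim_bin // ltW.
have prH : pr H = pr E * claim_tail h L.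
  rewrite (indep_claims1 indE) ?leqnn // pr_claim_gt.
  by rewrite /L; case: (k + b)%N (leq_trans k0 (leq_addr b k)).
have step : pr (E `&` crossing C h b i n.+1 k) <=
    \sum_(j < L) pr (F j `&` crossing C h b i.+1 n (L - j)) + pr H.
  apply: (@le_trans _ _ (pr (\big[setU/set0]_(j < L)
      (F j `&` crossing C h b i.+1 n (L - j)) `|` H))).
    apply: pr_sub; first exact: measurableI.
      by apply: measurableU => //; apply: bigsetU_measurable.
    move=> w [Ew cw]; have [wL|wL] := leP (C i w) (L.-1%:R * h).
      have [j jL jw] := claim_bin_cover wL; left.
      have {}jL : (j < L)%N by move: jL; rewrite /L; lia.
      rewrite -(bigcup_mkord L (fun j => F j `&` crossing C h b i.+1 n (L - j))).
      exists j => //; split; first by split.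
      by apply: crossing_step (claim_bin_le jw) => //; exact: ltnW.
    by right; split => //=; rewrite in_itv /= wL.
  apply: le_trans (pr_setU _ _) _ => //; first exact: bigsetU_measurable.
  by rewrite lerD2r; exact: (pr_bigsetU L mFc).
have -> : escape q b n.+1 y =
   \sum_(e < y + b) q * (1 - q) ^+ e * escape q b n ((y + b).-1 - e) by [].
apply: (@le_trans _ _ (pr E * \sum_(e < y + b) q * (1 - q) ^+ e *
     (\sum_(j < L) (claim_tail h j - claim_tail h j.+1) *
        g ((k - y + e).+1 - j)%N + claim_tail h L))); last first.
  rewrite [leRHS]mulrC ler_wpM2l ?pr_ge0 // gS ?subn_gt0 //.
  by rewrite /L; lia.
rewrite mulr_suml mulr_sumr; apply: ler_sum => e _.
have -> : pr E * (q * (1 - q) ^+ e *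
   (\sum_(j < L) (claim_tail h j - claim_tail h j.+1) *
        g ((k - y + e).+1 - j)%N + claim_tail h L)) =
   q * (1 - q) ^+ e * (\sum_(j < L) g ((k - y + e).+1 - j)%N * pr (F j) + pr H).
  rewrite prH; transitivity (q * (1 - q) ^+ e * (pr E *
   \sum_(j < L) (claim_tail h j - claim_tail h j.+1) *
        g ((k - y + e).+1 - j)%N + pr E * claim_tail h L)); first by ring.
  rewrite mulr_sumr; congr (_ * (_ + _)); apply: eq_bigr => j _.
  by rewrite prF; ring.
rewrite -[leLHS]mulrA; apply: ler_wpM2l; first by rewrite mulr_ge0 // exprn_ge0 // subr_ge0.
have ee0 := escape_ge0 b n ((y + b).-1 - e) q01.
have ee1 := escape_le1 b n ((y + b).-1 - e) q01.
apply: (le_trans (ler_wpM2l ee0 step)); rewrite mulrDr; apply: lerD; last first.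
  by rewrite ler_piMl // pr_ge0.
rewrite mulr_sumr; apply: ler_sum => j _.
apply: (le_trans (IH _ _ _ _ (HF j))).
(* The new level [k + b - j] minus the new reserve [y + b - 1 - e] is [k - y + e + 1 - j]: the
   premium [b] cancels and only the clock step [e + 1] remains. *)
rewrite le_eqVlt; apply/orP; left; apply/eqP; congr (g _ * _).
by have := ltn_ord e; have := ltn_ord j; rewrite /L; lia.
Qed.

End walk.

(** * Crossing probability for a deterministic premium *)

Section upper_bound.
Context {R : realType}.

(* The fourth clause is long-tailedness; the last one is a lattice form of
   [\int_0^x G (x - y) d(1 - G)(y) <= (1 + e) G x]. *)
Definition subexponential_tail (G : R -> R) : Prop :=
  [/\ forall x y, x <= y -> G y <= G x,
      forall x, x <= 0 -> G x = 1,
      forall x, 0 < G x,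
      forall y e, 0 < e -> exists x0, forall x, x0 <= x -> G (x - y) <= (1 + e) * G x &
      forall h e, 0 < h -> 0 < e -> exists n0, forall n, (n0 <= n)%N ->
        \sum_(i < n) (G (i%:R * h) - G (i.+1%:R * h)) * G ((n.-1 - i)%:R * h)
          <= (1 + e) * G (n%:R * h)].

(** With [q b = 1 + delta], [delta] small and [b] large, [q] is small as well and the constant
    approaches [rho / (1 - rho)]. *)
Lemma lattice_parameters (rho c : R) : 0 < rho -> rho / (1 - rho) < c -> rho < 1 ->
  exists (b : nat) (q : R), [/\ 0 < q < 1, 1 < q * b%:R, q + q * b%:R * rho < 1 &
    q * b%:R * rho / (1 - q - q * b%:R * rho) < c].
Proof.
move=> rho0 rhoc rho1.
have r1 : 0 < 1 - rho by lra.
have c0 : 0 < c by apply: lt_trans rhoc; rewrite divr_gt0.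
pose eta := c * (1 - rho) - rho.
have eta0 : 0 < eta by move: rhoc; rewrite ltr_pdivrMr // /eta; lra.
(* The slack is [eta = c (1 - rho) - rho]; [delta] and [b] are chosen so that [(1 + c) delta] and
   [c q] each stay below [eta / 3]. *)
pose delta := eta / (eta + 3 * (1 + c)).
have D0 : 0 < eta + 3 * (1 + c) by nra.
have de : delta * (eta + 3 * (1 + c)) = eta by rewrite /delta divfK // gt_eqF.
have d0 : 0 < delta by rewrite divr_gt0.
have d1 : delta < 1 by rewrite ltr_pdivrMr // mul1r; nra.
have dc : (1 + c) * delta < eta / 3 by nra.
pose b := Num.bound (6 * c / eta).
have bc : 6 * c / eta < b%:R.
  by apply: archi_boundP; rewrite divr_ge0 ?mulr_ge0 ?ltW.
have b0 : 0 < b%:R :> R by apply: lt_trans bc; rewrite divr_gt0 // mulr_gt0.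
rewrite ltr_pdivrMr // in bc.
pose q := (1 + delta) / b%:R.
have qb : q * b%:R = 1 + delta by rewrite divfK // gt_eqF.
have q0 : 0 < q by rewrite divr_gt0 //; lra.
have cq : c * q < eta / 3.
  rewrite -(ltr_pM2r b0) -mulrA qb.
  have : c * delta < c by rewrite gtr_pMr.
  by move: bc; lra.
have key : (1 + delta) * rho < c * (1 - q - (1 + delta) * rho).
  have : (1 + c) * delta * rho < eta / 3.
    apply: le_lt_trans dc; apply: ler_piMr; last lra.
    by apply: mulr_ge0; lra.
  by move: cq; rewrite /eta; nra.
have kap0 : 0 < (1 + delta) * rho by rewrite mulr_gt0 //; lra.
have pos : 0 < 1 - q - (1 + delta) * rho.
  by rewrite -(pmulr_rgt0 _ c0) (lt_trans kap0).
exists b, q; rewrite qb; split; [lra|lra|lra|].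
by rewrite ltr_pdivrMr.
Qed.

Lemma small_power (z e : R) : 0 <= z -> z < 1 -> 0 < e -> exists y : nat, z ^+ y <= e.
Proof.
move=> z0 z1 e0.
have : (fun n => z ^+ n) @ \oo --> (0 : R) by apply: cvg_expr; rewrite ger0_norm.
move=> /cvgrPdist_le /(_ _ e0) [y _ Hy]; exists y.
by have := Hy y (leqnn y); rewrite sub0r normrN ger0_norm // exprn_ge0.
Qed.

Context {d : measure_display} {T : measurableType d} (P : probability T R).
Variables (C : nat -> {RV P >-> R}) (B : R -> R) (G : R -> R) (m : R).
Hypothesis CB : forall i x, P [set w | C i w <= x] = (B x)%:E.
Hypothesis m0 : 0 < m.
Hypothesis Gtail : subexponential_tail G.
Hypothesis BG : forall x y, 0 <= x -> x <= y -> (y - x) * (1 - B y) <= m * (G x - G y).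

Definition drift_crossing (a u : R) (n : nat) : set T :=
  \bigcup_(l in `I_n.+1) [set w | u + l%:R * a <= \sum_(0 <= j < l) C j w].

Lemma measurable_drift_crossing a u n : measurable (drift_crossing a u n).
Proof.
apply: bigcup_measurable => l _.
rewrite (_ : [set w | _] = setT `&`
   (fun w => \sum_(0 <= j < l) C j w) @^-1` `[u + l%:R * a, +oo[).
  by apply: measurable_sumC.
by rewrite setTI; apply/seteqP; split => w /=; rewrite in_itv /= andbT.
Qed.

(** The lattice crossing, damped by [escape], is bounded by the compound tail at a level lowered by
    the reserve [y]. The bound is relative to a past [E] so that it can be applied on arrival
    events. *)
Lemma drift_crossing_prob a c : m < a -> m / (a - m) < c ->
  exists u0, forall u n E, u0 <= u -> indep_claims C 0 n E ->
    pr P (E `&` drift_crossing a u n) <= c * G u * pr P E.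
Proof.
move=> ma mc; have m00 := m0; have a0 : 0 < a by lra.
have [Gle G1 G0 Glong Gsub] := Gtail.
have rho0 : 0 < m / a by rewrite divr_gt0.
have rhoE : m / a / (1 - m / a) = m / (a - m).
  by field; rewrite ?gt_eqF ?subr_gt0.
have rho1 : m / a < 1 by rewrite ltr_pdivrMr // mul1r.
have [b [q [/andP[q0 q1] qb kq kc]]] : exists (b : nat) (q : R),
  [/\ 0 < q < 1, 1 < q * b%:R, q + q * b%:R * (m / a) < 1 &
    q * b%:R * (m / a) / (1 - q - q * b%:R * (m / a)) < c].
  by apply: lattice_parameters; rewrite ?rhoE.
set k := q * b%:R * (m / a) in kq kc.
have b0 : 0 < b%:R :> R by rewrite -(pmulr_rgt0 _ q0); lra.
have k0 : 0 < k by exact: mulr_gt0 (mulr_gt0 q0 b0) rho0.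
pose h := a / b%:R; have h0 : 0 < h by rewrite divr_gt0.
have hb : b%:R * h = a by rewrite /h mulrC divfK // gt_eqF.
have hle i j : (i <= j)%N -> i%:R * h <= j%:R * h.
  by move=> ij; rewrite ler_wpM2r ?ler_nat // ltW.
pose g0 i := G (i%:R * h).
have g0d i : g0 i.+1 <= g0 i by apply/Gle/hle.
have [g [g1 gd gge0 gE grec]] : exists g : nat -> R, [/\ g 0%N = 1,
  (forall i, g i.+1 <= g i), (forall n, 0 <= g n),
    (forall n, (1 - q) * (g n.+1 - g n.+2) =
       \sum_(i < n.+1) k * (g0 i - g0 i.+1) * (g (n - i)%N - g (n - i).+1)) &
    (forall n, (1 - q) * g n.+1 =
       k * g0 n + \sum_(i < n) k * (g0 i - g0 i.+1) * g (n - i)%N)].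
  apply: (compound_tail_exists (ltW q0) (ltW k0) kq g0d) => [i|].
    exact/ltW/G0.
  by rewrite /g0 mul0r G1.
have gle1 n : g n <= 1.
  by elim: n => [|n IH]; [rewrite g1 | exact: le_trans IH].
pose c1 := (k / (1 - q - k) + c) / 2.
have c1k : k / (1 - q - k) < c1 by rewrite /c1; lra.
have c1c : c1 < c by rewrite /c1; lra.
have c10 : 0 < c1 by apply: lt_trans c1k; rewrite divr_gt0 //; lra.
have [n0 Hn0] : exists n0, forall n, (n0 <= n)%N -> g n.+1 <= c1 * g0 n.
  apply: (@compound_asymptotics R q k g0 (fun n => g n.+1)) => //.
  - by move=> l; exact: G0.
  - move=> l e e0; have [x0 Hx0] := Glong (l%:R * h) e e0.
    exists (l + Num.bound (`|x0| / h))%N => n Hn.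
    rewrite /g0 natrB ?mulrBl; last by rewrite (leq_trans _ Hn) // leq_addr.
    apply: Hx0; rewrite (le_trans (ler_norm x0)) // -ler_pdivrMr //.
    have := archi_boundP (divr_ge0 (normr_ge0 x0) (ltW h0)).
    move=> /ltW /le_trans; apply; rewrite ler_nat.
    by rewrite (leq_trans _ Hn) // leq_addl.
  - by move=> e e0; exact: Gsub.
  - move=> [|n]; rewrite grec; congr (_ + _); first by rewrite !big_ord0.
    by apply: eq_bigr => i _; rewrite subSn // -ltnS.
(* The compound tail costs [c1], the shift of the level [c / c2], and [escape] is at least
   [c1 / c2]; the quotient is exactly [c]. *)
pose c2 := (c1 + c) / 2.
have c12 : c1 < c2 by rewrite /c2; lra.
have c2c : c2 < c by rewrite /c2; lra.
have c20 : 0 < c2 by lra.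
have [z [qz z1 zb]] : exists z, [/\ 1 - q < z, z < 1 & q * z ^+ b <= z - (1 - q)].
  by apply: escape_root => //; rewrite q0.
have z0 : 0 < z by lra.
have [y Hy] : exists y : nat, z ^+ y <= 1 - c1 / c2.
  by apply: small_power; rewrite ?ltW // subr_gt0 ltr_pdivrMr // mul1r.
(* The shift covers the reserve [y], the rounding of [u] down to the lattice, and the index shift in
   [g n.+1 <= c1 * g0 n]. *)
have [x0 Hx0] := Glong (y.+2%:R * h) (c / c2 - 1)
  ltac:(by rewrite subr_gt0 ltr_pdivlMr // mul1r).
exists (`|x0| + (n0 + y).+2%:R * h) => u n E u0 indE.
have uh : (n0 + y).+2%:R * h <= u by rewrite (le_trans _ u0) // lerDr.
have ux0 : x0 <= u.
  rewrite (le_trans _ u0) // (le_trans (ler_norm x0)) // lerDl.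
  by rewrite mulr_ge0 // ltW.
have uge0 : 0 <= u / h.
  apply: divr_ge0; last exact: ltW.
  by apply: le_trans uh; rewrite mulr_ge0 // ltW.
have [kk /andP[ku uk]] : exists kk, kk%:R * h <= u < kk.+1%:R * h.
  exists (Num.truncn (u / h)).
  by rewrite -ler_pdivlMr // -ltr_pdivrMr // truncn_itv.
have mE := indE.1.
have step1 : pr P (E `&` drift_crossing a u n) <=
    pr P (E `&` crossing C h b 0 n kk).
  apply: pr_sub; try (apply: measurableI => //).
  - exact: measurable_drift_crossing.
  - exact: measurable_crossing.
  move=> w [Ew [l ln /= Hl]]; split => //; exists l => //=.
  rewrite add0n (le_trans _ Hl) // natrD mulrDl natrM -mulrA hb.
  by rewrite lerD2r.
have q01 : 0 <= q <= 1 by rewrite !ltW.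
have step2 : escape q b n y * pr P (E `&` crossing C h b 0 n kk) <=
    g (kk - y)%N * pr P E.
  apply: (crossing_prob CB) => //.
  move=> m' Y L m'0 m'L.
  apply: (@compound_tail_superharmonic R q (fun i => k * (g0 i - g0 i.+1))) => //.
    by rewrite /= gerBl; exact: claim_df_ge0 CB _.
  (* As [k h = q m], the bound [BG] over one mesh says that [q P(X >= i + 2)] is at most the
     ladder-height mass [k (g0 i - g0 (i + 1))]. *)
  move=> i /=; have := @BG (i%:R * h) (i.+1%:R * h).
  rewrite mulr_ge0 ?(ltW h0) // => /(_ isT (hle _ _ (leqnSn i))).
  have -> : i.+1%:R * h - i%:R * h = h by rewrite -natr1; ring.
  rewrite -/(g0 i) -/(g0 i.+1) => H; rewrite -(ler_pM2r h0).
  have -> : k * (g0 i - g0 i.+1) * h = q * (m * (g0 i - g0 i.+1)).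
    have kh : k * h = q * m by rewrite /k /h; field; rewrite !gt_eqF.
    by rewrite mulrAC kh mulrA.
  by rewrite -mulrA [_ * h]mulrC; apply: ler_wpM2l => //; exact: ltW.
have step3 : g (kk - y)%N <= c1 * (c / c2 * G u).
  have ky : ((n0 + y).+1 < kk.+1)%N.
    rewrite -(ltr_nat R) -(ltr_pM2r h0) (le_lt_trans _ uk) //.
    rewrite (le_trans _ uh) // hle //.
  have [yk n0k] : (y < kk)%N /\ (n0 <= kk - y.+1)%N by move: ky; clear; lia.
  rewrite -subnSK // (le_trans (Hn0 _ n0k)) //.
  rewrite ler_wpM2l ?(ltW c10) // .
  rewrite (_ : c / c2 = 1 + (c / c2 - 1)); last by ring.
  apply: (le_trans _ (Hx0 u ux0)).
  apply: Gle; rewrite natrB //.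
  rewrite lerBlDr (_ : _ + _ = kk.+1%:R * h); first exact: ltW.
  by rewrite -!natr1; ring.
have esc : c1 / c2 <= escape q b n y.
  apply: (@le_trans _ _ (1 - z ^+ y)); first by lra.
  by apply: escape_ge => //; rewrite ?q0 ltW.
have cc0 : 0 < c1 / c2 by rewrite divr_gt0.
apply: (le_trans step1); rewrite -(ler_pM2l cc0).
apply: (@le_trans _ _ (escape q b n y * pr P (E `&` crossing C h b 0 n kk))).
  by rewrite ler_wpM2r // pr_ge0.
apply: (le_trans step2).
have -> : c1 / c2 * (c * G u * pr P E) = c1 * (c / c2 * G u) * pr P E by ring.
by rewrite ler_wpM2r // pr_ge0.
Qed.

End upper_bound.

(** * Tail properties extracted from the convolution ratio of an i.i.d. pair *)

Section convolution_tail.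
Context {R : realType} {d : measure_display} {T : measurableType d}.
Variables (Q : probability T R) (X1 X2 : {RV Q >-> R}) (F : R -> R).
Hypothesis F1 : forall x, Q [set w | X1 w <= x] = (F x)%:E.
Hypothesis F2 : forall x, Q [set w | X2 w <= x] = (F x)%:E.
Hypothesis indep : forall A B : set R, measurable A -> measurable B ->
  Q (X1 @^-1` A `&` X2 @^-1` B) = (Q (X1 @^-1` A) * Q (X2 @^-1` B))%E.
Hypothesis X1_ge0 : forall w, 0 <= X1 w.
Hypothesis X2_ge0 : forall w, 0 <= X2 w.
Hypothesis Fy : F @ +oo --> (1 : R).
Hypothesis ratio : (fine (Q [set w | X1 w + X2 w > x]) / fine (Q [set w | X1 w > x]))
      @[x --> +oo] --> (2 : R).

Let G (x : R) : R := 1 - F x.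
Let S (x : R) := [set w | X1 w + X2 w > x].

Let measurable_S x : measurable (S x).
Proof.
rewrite (_ : S x = setT `&` (X1 \+ X2)%R @^-1` `]x, +oo[).
  by apply: measurable_funD.
by rewrite setTI; apply/seteqP; split => w /=; rewrite in_itv /= andbT.
Qed.

Let prI (A B : set R) : measurable A -> measurable B ->
  pr Q (X1 @^-1` A `&` X2 @^-1` B) = pr Q (X1 @^-1` A) * pr Q (X2 @^-1` B).
Proof.
move=> mA mB; apply: EFin_inj; rewrite EFinM -!prE ?indep //.
- exact: measurable_RV.
- exact: measurable_RV.
- by apply: measurableI; exact: measurable_RV.
Qed.

Let pr_le (X : {RV Q >-> R}) : (forall x, Q [set w | X w <= x] = (F x)%:E) ->
  forall x, pr Q (X @^-1` `]-oo, x]%classic) = F x.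
Proof. by move=> H x; exact: (pr_claim_le (C := fun=> X) (fun=> H) 0). Qed.

Let pr_gt (X : {RV Q >-> R}) : (forall x, Q [set w | X w <= x] = (F x)%:E) ->
  forall x, pr Q (X @^-1` `]x, +oo[%classic) = G x.
Proof. by move=> H x; exact: (pr_claim_gt (C := fun=> X) (fun=> H) 0). Qed.

Let pr_oc (X : {RV Q >-> R}) : (forall x, Q [set w | X w <= x] = (F x)%:E) ->
  forall x y, x <= y -> pr Q (X @^-1` `]x, y]%classic) = G x - G y.
Proof.
move=> H x y xy; rewrite -!(pr_gt H) -pr_setD; try exact: measurable_RV.
  congr pr; apply/seteqP; split => w /=; rewrite !in_itv /= !andbT.
    by move=> /andP[-> Xy]; split => //; rewrite ltNge Xy.
  by move=> [-> /negP]; rewrite -leNgt.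
by move=> w /=; rewrite !in_itv /= !andbT => /(le_lt_trans xy).
Qed.

Let Gle x y : x <= y -> G y <= G x.
Proof.
move=> xy; rewrite -!(pr_gt F1); apply: pr_sub; try exact: measurable_RV.
by move=> w /=; rewrite !in_itv /= !andbT => /(le_lt_trans xy).
Qed.

Let Gcvg (e : R) : 0 < e -> exists x0, forall x, x0 <= x -> G x <= e.
Proof.
move=> e0; move/cvgrPdist_le : Fy => /(_ e e0) [x0 [_ H]].
exists (x0 + 1) => x xx; rewrite /G (le_trans (ler_norm _)) // H //.
by rewrite (lt_le_trans _ xx) // ltrDl.
Qed.

Let ratio_le (e : R) : 0 < e -> exists x0, forall x, x0 <= x ->
  `|2 - pr Q (S x) / G x| <= e.
Proof.
move=> e0; move/cvgrPdist_le : ratio => /(_ e e0) [x0 [_ H]].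
exists (x0 + 1) => x xx; have := H x; rewrite -(pr_gt F1) /pr.
rewrite (_ : X1 @^-1` _ = [set w | X1 w > x]); last first.
  by apply/seteqP; split => w /=; rewrite in_itv /= andbT.
by apply; rewrite (lt_le_trans _ xx) // ltrDl.
Qed.

(** If the tail vanished at some point, the ratio would be a division by zero from there on, hence
    [0] by convention, and could not tend to [2]. *)
Let G0 x : 0 < G x.
Proof.
rewrite lt_neqAle -{2}(pr_gt F1) pr_ge0 andbT; apply/negP => /eqP Gx.
have [x0 H] := ratio_le (ltr01 : 0 < 1 :> R).
have := H (Num.max x x0); rewrite le_max lexx orbT => /(_ isT).
have -> : G (Num.max x x0) = 0.
  apply/eqP; rewrite eq_le -{2}(pr_gt F1) pr_ge0 andbT Gx; apply: Gle.
  by rewrite le_max lexx.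
by rewrite invr0 mulr0 subr0 ger0_norm //; lra.
Qed.

Let S_le (e : R) : 0 < e -> exists x0, forall x, x0 <= x -> pr Q (S x) <= (2 + e) * G x.
Proof.
move=> e0; have [x0 H] := ratio_le e0; exists x0 => x /H.
rewrite distrC => /(le_trans (ler_norm _)).
by rewrite lerBlDr ler_pdivrMr // [e + 2]addrC.
Qed.

Lemma pr_disjointU (A B : set T) : measurable A -> measurable B ->
  (forall w, A w -> ~ B w) -> pr Q (A `|` B) = pr Q A + pr Q B.
Proof.
move=> mA mB AB; apply: EFin_inj; rewrite EFinD -!prE //; last exact: measurableU.
by rewrite measureU //; apply/seteqP; split => // w [/AB].
Qed.

(** For [0 < y <= x], [X1 + X2 > x] contains three disjoint events: [X1 > x]; [X1 <= y] with
    [X2 > x]; [y < X1 <= x] with [X2 > x - y]. Comparison with [(2 + e') G x] leaves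
    [(G y - G x) G (x - y) <= (G y + e') G x]. *)
Let long (y e : R) : 0 < e -> exists x0, forall x, x0 <= x -> G (x - y) <= (1 + e) * G x.
Proof.
move=> e0; have [y0|y0] := leP y 0.
  exists 0 => x _; rewrite (@le_trans _ _ (G x)) //.
    by apply: Gle; rewrite lerDl oppr_ge0.
  by rewrite ler_peMl ?(ltW (G0 _)) // lerDl ltW.
(* The solution of [G y + e' = (1 + e) (G y - e')]. *)
pose e' := e * G y / (2 + e).
have Gy := G0 y.
have e'E : e' * (2 + e) = e * G y by rewrite /e' divfK // gt_eqF //; lra.
have e'0 : 0 < e' by rewrite divr_gt0 ?mulr_gt0 //; lra.
have [x1 H1] := S_le e'0; have [x2 H2] := Gcvg e'0.
exists (`|x1| + `|x2| + y) => x xx.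
have [n1 n2] := (normr_ge0 x1, normr_ge0 x2).
have [l1 l2] := (ler_norm x1, ler_norm x2).
have {}H1 := H1 x ltac:(lra); have {}H2 := H2 x ltac:(lra).
have yx : y <= x by lra.
pose A1 := X1 @^-1` `]x, +oo[.
pose A2 := X1 @^-1` `]-oo, y] `&` X2 @^-1` `]x, +oo[.
pose A3 := X1 @^-1` `]y, x] `&` X2 @^-1` `]x - y, +oo[.
have mA1 : measurable A1 by exact: measurable_RV.
have mA2 : measurable A2 by apply: measurableI; exact: measurable_RV.
have mA3 : measurable A3 by apply: measurableI; exact: measurable_RV.
have : pr Q (A1 `|` A2 `|` A3) <= pr Q (S x).
  apply: pr_sub => //; first by do 2 apply: measurableU => //.
  move=> w; rewrite /A1 /A2 /A3 /S /= !in_itv /= !andbT.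
  have := X1_ge0 w; have := X2_ge0 w.
  by move=> ? ? [[|[]]|[/andP[]]]; lra.
rewrite !pr_disjointU //; first last.
- move=> w; rewrite /A1 /A2 /A3 /= !in_itv /= !andbT => H [] /andP[H3 H4] _.
  case: H => [H|[H _]].
    by have := lt_le_trans H H4; rewrite ltxx.
  by have := lt_le_trans H3 H; rewrite ltxx.
- by apply: measurableU.
- move=> w; rewrite /A1 /A2 /= !in_itv /= !andbT => H3 [H4 _].
  by have := lt_le_trans H3 (le_trans H4 yx); rewrite ltxx.
rewrite !prI // (pr_gt F1) !(pr_gt F2) (pr_le F1) (pr_oc F1) // => H3.
have Fy1 : F y = 1 - G y by rewrite /G; ring.
rewrite Fy1 in H3.
have Gxy := G0 (x - y).
have H4 : (G y - e') * G (x - y) <= (G y + e') * G x.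
  have : (G y - e') * G (x - y) <= (G y - G x) * G (x - y).
    by rewrite ler_wpM2r ?(ltW Gxy) //; lra.
  by lra.
have H5 : G y + e' = (1 + e) * (G y - e') by lra.
have H6 : 0 < G y - e'.
  have : 0 < (1 + e) * (G y - e') by rewrite -H5; lra.
  by rewrite pmulr_rgt0 //; lra.
by rewrite -(ler_pM2l H6) (le_trans H4) // H5 [leRHS]mulrCA mulrA.
Qed.

(** Cutting [X1 + X2 > n h] along the lattice cell of [X1] gives disjoint events whose probabilities
    dominate the terms of the sum, and leaves [X1 > (n + 1) h]. That remainder accounts for one of
    the two units of the ratio. *)
Let lattice (h e : R) : 0 < h -> 0 < e -> exists n0, forall n, (n0 <= n)%N ->
  \sum_(i < n) (G (i%:R * h) - G (i.+1%:R * h)) * G ((n.-1 - i)%:R * h)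
    <= (1 + e) * G (n%:R * h).
Proof.
(* This ensures [(2 + e') (1 + e') <= 2 + e]. *)
move=> h0 e0; pose e' := Num.min 1 (e / 4).
have e'0 : 0 < e' by rewrite lt_min ltr01 divr_gt0.
have e'1 : e' <= 1 by rewrite ge_min lexx.
have e'e : e' <= e / 4 by rewrite ge_min lexx orbT.
have [x1 H1] := S_le e'0; have [x2 H2] := long h e'0.
exists (Num.bound ((`|x1| + `|x2|) / h)).+1 => -[//|n]; rewrite ltnS => nb.
have hle i j : (i <= j)%N -> i%:R * h <= j%:R * h.
  by move=> ij; rewrite ler_wpM2r ?ler_nat // ltW.
have nh : `|x1| + `|x2| <= n%:R * h.
  rewrite -ler_pdivrMr // (le_trans (ltW (archi_boundP _))) ?ler_nat //.
  by rewrite divr_ge0 ?addr_ge0 // ltW.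
have [n1 n2] := (normr_ge0 x1, normr_ge0 x2).
have [l1 l2] := (ler_norm x1, ler_norm x2).
have {}H1 := H1 (n%:R * h) ltac:(lra).
have nS : n.+1%:R * h - h = n%:R * h by rewrite -natr1; ring.
have {}H2 := H2 (n.+1%:R * h) ltac:(have := hle _ _ (leqnSn n); lra).
rewrite nS in H2.
pose W k := S (n%:R * h) `&` X1 @^-1` `]k%:R * h, +oo[.
have mW k : measurable (W k) by apply: measurableI => //; exact: measurable_RV.
have key k : (k <= n.+1)%N ->
   \sum_(i < k) (G (i%:R * h) - G (i.+1%:R * h)) * G ((n - i)%:R * h) + pr Q (W k)
     <= pr Q (S (n%:R * h)).
  elim: k => [|k IH] kn.
    by rewrite big_ord0 add0r; apply: pr_sub => // w [].
  apply: le_trans (IH (ltnW kn)); rewrite big_ord_recr /= -addrA lerD2l.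
  rewrite -(pr_oc F1) ?hle // -(pr_gt F2) -prI //.
  rewrite -pr_disjointU //; last 2 first.
  - by apply: measurableI; exact: measurable_RV.
  - move=> w /=; rewrite /W /= !in_itv /= !andbT => -[/andP[_ H _]] [_].
    by rewrite ltNge H.
  apply: pr_sub => //.
    by apply: measurableU => //; apply: measurableI; exact: measurable_RV.
  move=> w /=; rewrite /W /S /= !in_itv /= !andbT.
  have kh := hle _ _ (leqnSn k).
  case=> [[/andP[kX Xk] nX]|[nX kX]]; split => //; last exact: le_lt_trans kX.
  by have := ltrD kX nX; rewrite -mulrDl -natrD subnKC.
have := key _ (leqnn n.+1).
have -> : pr Q (W n.+1) = G (n.+1%:R * h).
  rewrite -(pr_gt F1); congr pr; apply/seteqP; split => w; first by case.
  move=> wn; split => //; move: wn; rewrite /S /= in_itv /= andbT => wn.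
  have := X2_ge0 w; have := hle _ _ (leqnSn n); lra.
move=> H3; have Gp := G0 (n.+1%:R * h).
move: H3 H1 H2; move: (\sum_(i < _) _) (pr Q _) Gp => s p.
move: (G (n%:R * h)) (G (n.+1%:R * h)) => g1 g2 g20 H3 H1 H2.
have : (2 + e') * g1 <= (2 + e') * ((1 + e') * g2) by rewrite ler_wpM2l //; lra.
have : e' * e' * g2 <= e' * g2 by rewrite -mulrA ler_piMl // mulr_ge0 // ltW.
have : e' * g2 <= e / 4 * g2 by rewrite ler_wpM2r // ltW.
lra.
Qed.

Lemma convolution_subexponential_tail : (forall x, x <= 0 -> F x = 0) ->
  subexponential_tail (fun x => 1 - F x).
Proof. by move=> F0; split => // x /F0 ->; rewrite subr0. Qed.

End convolution_tail.

(** * An i.i.d. pair with a prescribed distribution function *)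

Section stieltjes_square.
Context {R : realType} (F : R -> R).
Hypotheses (Fnd : nondecreasing F)
  (Frc : forall x, F%function @ at_right x --> F x)
  (FNy : F @ -oo --> (0 : R)) (Fy : F @ +oo --> (1 : R)).

Definition stieltjes_cdf : cumulativeBounded (0 : R) (1 : R) :=
  HB.pack F (isCumulative.Build R _ R F Fnd Frc)
    (isCumulativeBounded.Build R 0 1 F FNy Fy).

Definition stieltjes_prob : probability (measurableTypeR R) R :=
  lebesgue_stieltjes_measure stieltjes_cdf.

(** [subexponential] quantifies over all i.i.d. pairs with law [F], so a pair must be exhibited
    before the limit can be used; the two coordinates on this product provide it. *)
Definition stieltjes_sq :
  probability (measurableTypeR R * measurableTypeR R)%type R :=
  (stieltjes_prob \x stieltjes_prob)%E.

(* Truncation at [0] makes the variables nonnegative everywhere rather than almost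
   surely; it does not affect the law, as [F] vanishes on the negative reals. *)
Definition pos_fst (w : measurableTypeR R * measurableTypeR R) : R := Num.max w.1 0.
Definition pos_snd (w : measurableTypeR R * measurableTypeR R) : R := Num.max w.2 0.

Lemma measurable_pos_fst : measurable_fun setT pos_fst.
Proof. by apply: measurable_maxr => //; exact: measurable_fst. Qed.

Lemma measurable_pos_snd : measurable_fun setT pos_snd.
Proof. by apply: measurable_maxr => //; exact: measurable_snd. Qed.

HB.instance Definition _ := isMeasurableFun.Build _ _ _ _ pos_fst measurable_pos_fst.
HB.instance Definition _ := isMeasurableFun.Build _ _ _ _ pos_snd measurable_pos_snd.

Let pos (x : measurableTypeR R) : R := Num.max (x : R) 0.

Let mpos (A : set R) : measurable A -> measurable (pos @^-1` A).
Proof.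
move=> mA; rewrite -[X in measurable X]setTI.
suff : measurable_fun setT pos by apply.
by apply: measurable_maxr => //; exact: measurable_id.
Qed.

Let sq_rect (A B : set R) : measurable A -> measurable B ->
  stieltjes_sq (pos_fst @^-1` A `&` pos_snd @^-1` B) =
  (stieltjes_prob (pos @^-1` A) * stieltjes_prob (pos @^-1` B))%E.
Proof. by move=> mA mB; rewrite -product_measure1E //; exact: mpos. Qed.

Let prob_pos (x : R) : (forall y, y < 0 -> F y = 0) ->
  stieltjes_prob (pos @^-1` `]-oo, x]%classic) = (F x)%:E.
Proof.
move=> F0; have [x0|x0] := leP 0 x.
  rewrite -[RHS](cdf_lebesgue_stieltjes_id stieltjes_cdf x).
  congr (lebesgue_stieltjes_measure _ _); apply/seteqP; split => y /=;
    by rewrite !in_itv /= ge_max x0 andbT.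
rewrite F0 // (_ : _ @^-1` _ = set0) ?measure0 //.
apply/seteqP; split => // y /=; rewrite in_itv /= ge_max => /andP[_].
by rewrite leNgt x0.
Qed.

Lemma stieltjes_subexponential_tail : subexponential F -> F 0 = 0 ->
  subexponential_tail (fun x => 1 - F x).
Proof.
move=> [[_ [_ [F0 _]]] H] F00.
pose X1 : {RV stieltjes_sq >-> R} := pos_fst.
pose X2 : {RV stieltjes_sq >-> R} := pos_snd.
have setTpos : pos @^-1` setT = setT by [].
have F1 x : stieltjes_sq [set w | X1 w <= x] = (F x)%:E.
  transitivity (stieltjes_sq (pos_fst @^-1` `]-oo, x] `&` pos_snd @^-1` setT)).
    by congr (stieltjes_sq _); apply/seteqP; split => w /=; rewrite in_itv //= => -[].
  by rewrite sq_rect // prob_pos // setTpos probability_setT mule1.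
have F2 x : stieltjes_sq [set w | X2 w <= x] = (F x)%:E.
  transitivity (stieltjes_sq (pos_fst @^-1` setT `&` pos_snd @^-1` `]-oo, x])).
    by congr (stieltjes_sq _); apply/seteqP; split => w /=; rewrite in_itv //= => -[].
  by rewrite sq_rect // prob_pos // setTpos probability_setT mul1e.
have indep (A B : set R) : measurable A -> measurable B ->
  stieltjes_sq (X1 @^-1` A `&` X2 @^-1` B) =
   (stieltjes_sq (X1 @^-1` A) * stieltjes_sq (X2 @^-1` B))%E.
  move=> mA mB; rewrite sq_rect //.
  have -> : X1 @^-1` A = pos_fst @^-1` A `&` pos_snd @^-1` setT.
    by rewrite preimage_setT setIT.
  have -> : X2 @^-1` B = pos_fst @^-1` setT `&` pos_snd @^-1` B.
    by rewrite preimage_setT setTI.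
  by rewrite !sq_rect // setTpos probability_setT mule1 mul1e.
apply: (convolution_subexponential_tail F1 F2 indep) => //.
- by move=> w; rewrite /X1 /= /pos_fst le_max lexx orbT.
- by move=> w; rewrite /X2 /= /pos_snd le_max lexx orbT.
- exact: H.
- by move=> x; rewrite le_eqVlt => /predU1P[->|/F0].
Qed.

End stieltjes_square.

Lemma subexponentialP (R : realType) (F : R -> R) : subexponential F -> F 0 = 0 ->
  subexponential_tail (fun x => 1 - F x).
Proof.
move=> SF; have [[nd [rc [F0 Fy]]] _] := SF.
have FNy : F @ -oo --> (0 : R).
  apply: cvg_near_cst; exists 0; split => // x x0; exact: F0.
exact: stieltjes_subexponential_tail.
Qed.

(** * Increments of the integrated tail distribution *)

Section integrated_tail_bounds.
Context {R : realType} (B : R -> R).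
Hypotheses (Bnd : forall x y, x <= y -> B x <= B y) (B0 : forall x, 0 <= B x)
  (B1 : forall x, B x <= 1).
Local Notation mu := (@lebesgue_measure R).

Let mf (D : set R) : measurable D -> measurable_fun D (EFin \o (fun y : R => (1 - B y : R))).
Proof.
move=> mD; apply/measurable_EFinP; apply: nonincreasing_measurable => // x y xy.
by rewrite lerD2l lerN2 Bnd.
Qed.

Let f0 x : (0 <= (1 - B x)%:E)%E.
Proof. by rewrite lee_fin subr_ge0. Qed.

Let int_le (i : interval R) (c : R) : (forall y, y \in i -> 1 - B y <= c) ->
  (\int[mu]_(y in [set` i]) (1 - B y)%:E <= c%:E * mu [set` i])%E.
Proof.
move=> H; rewrite -integral_cst //; apply: ge0_le_integral => //.
exact: mf.
Qed.

Let int_ge (i : interval R) (c : R) : 0 <= c -> (forall y, y \in i -> c <= 1 - B y) ->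
  (c%:E * mu [set` i] <= \int[mu]_(y in [set` i]) (1 - B y)%:E)%E.
Proof.
move=> c0 H; rewrite -integral_cst //; apply: ge0_le_integral => //.
exact: mf.
Qed.

(** The middle term is the integral over []x, y]] of the nonincreasing function [1 - B], which lies
    between its endpoint values. *)
Lemma integrated_tail_bounds (m x y : R) : m != 0 -> 0 <= x -> x <= y ->
  (y - x) * (1 - B y) <= m * (integrated_tail m B y - integrated_tail m B x)
    <= (y - x) * (1 - B x).
Proof.
move=> m0 x0 xy; pose J z := (\int[mu]_(t in `[0%R, z]) (1 - B t)%:E)%E.
have Jfin z : 0 <= z -> J z \is a fin_num.
  move=> z0; rewrite ge0_fin_numE; last exact: integral_ge0.
  have H : (J z <= 1%:E * mu `[0%R, z])%E.
    by apply: int_le => t _; rewrite gerBl.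
  by rewrite (le_lt_trans H) // mul1e lebesgue_measure_itv /=; case: ifP;
    rewrite ?ltry.
pose K := (\int[mu]_(t in `]x, y]) (1 - B t)%:E)%E.
have KE : (mu `]x, y] = (y - x)%:E)%E.
  rewrite lebesgue_measure_itv /= lte_fin; case: ltP => // yx.
  by rewrite (@le_anti _ _ x y) ?xy // subrr.
have K1 : (((y - x) * (1 - B y))%:E <= K)%E.
  rewrite mulrC EFinM -KE; apply: int_ge; first by rewrite subr_ge0.
  by move=> t; rewrite in_itv /= => /andP[_ ty]; rewrite lerD2l lerN2 Bnd.
have K2 : (K <= ((y - x) * (1 - B x))%:E)%E.
  rewrite mulrC EFinM -KE; apply: int_le.
  by move=> t; rewrite in_itv /= => /andP[/ltW xt _]; rewrite lerD2l lerN2 Bnd.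
have Kfin : K \is a fin_num.
  rewrite ge0_fin_numE; last exact: integral_ge0.
  by rewrite (le_lt_trans K2) // ltry.
have JE : (J y = J x + K)%E.
  rewrite /J /K -ge0_integral_setU //.
  - by rewrite -itv_bndbnd_setU // bnd_simp.
  - by apply: mf; apply: measurableU.
  - apply/disj_setPS => t [] /=; rewrite !in_itv /= => /andP[_ tx] /andP[xt _].
    by have := lt_le_trans xt tx; rewrite ltxx.
have -> : m * (integrated_tail m B y - integrated_tail m B x) = fine K.
  have ITE z : integrated_tail m B z = m^-1 * fine (J z) by [].
  rewrite !ITE JE (fineD (Jfin x x0) Kfin).
  by rewrite -mulrBr mulVKf // addrAC subrr add0r.
by rewrite -!lee_fin fineK // K1 K2.
Qed.

Lemma integrated_tail0 (m : R) : integrated_tail m B 0 = 0.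
Proof.
by rewrite /integrated_tail set_itv1 integral_set1 mulr0.
Qed.

End integrated_tail_bounds.

(** * Exponential bounds on arrival times from the large deviation principle *)

Section counting_process.
Context {R : realType} {d : measure_display} {T : measurableType d}.
Variables (P : probability T R) (tau : nat -> {RV P >-> R}) (N : R -> T -> nat).
Hypothesis NE : forall (t : R) w n, 0 <= t -> ((n <= N t w)%N <-> tau n w <= t).

Lemma arrival_le t n : 0 <= t -> [set w | tau n w <= t] = [set w | (n <= N t w)%N].
Proof. by move=> t0; apply/seteqP; split => w /(NE w n t0). Qed.

Lemma arrival_gt t n : 0 <= t -> [set w | t < tau n w] = [set w | (N t w < n)%N].
Proof.
move=> t0; apply/seteqP; split => w /=; rewrite !ltNge.
  by move=> H; rewrite ltnNge; apply: contra H => /(NE w n t0).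
by rewrite ltnNge => H; apply: contra H => /(NE w n t0).
Qed.

Lemma measurable_arrival_le t n : measurable [set w | tau n w <= t].
Proof.
rewrite (_ : [set w | _] = tau n @^-1` `]-oo, t]); first exact: measurable_RV.
by apply/seteqP; split => w /=; rewrite in_itv.
Qed.

Lemma measurable_arrival_gt t n : measurable [set w | t < tau n w].
Proof.
rewrite (_ : [set w | _] = tau n @^-1` `]t, +oo[); first exact: measurable_RV.
by apply/seteqP; split => w /=; rewrite in_itv /= andbT.
Qed.

Lemma measurable_counting t (A : set nat) : 0 <= t -> measurable (N t @^-1` A).
Proof.
move=> t0; have -> : N t @^-1` A = \bigcup_(n in A) (N t @^-1` [set n]).
  apply/seteqP; split => [w Aw|w [n An /= Nn]]; first by exists (N t w).
  by rewrite /= Nn.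
apply: bigcup_measurable => n _.
have -> : N t @^-1` [set n] = [set w | (n <= N t w)%N] `&` [set w | (N t w < n.+1)%N].
  apply/seteqP; split => w /=; first by move=> ->.
  by move=> [H1 H2]; apply/eqP; rewrite eqn_leq H1 andbT -ltnS.
rewrite -arrival_le // -arrival_gt //; apply: measurableI.
  exact: measurable_arrival_le.
exact: measurable_arrival_gt.
Qed.

Variables (mu : R) (I : R -> \bar R).
Let X (t : R) (w : T) : R := (N t w)%:R / t.
Hypothesis ldp : LDP P X I.
Hypothesis I_eq0 : forall x, I x = 0%E <-> x = mu.
Hypothesis I_inc : forall x y : R, mu <= x -> x <= y -> (I x <= I y)%E.
Hypothesis I_dec : forall x y : R, 0 <= x -> x <= y -> y <= mu -> (I y <= I x)%E.

(** [N t / t] is never negative, so the lower bound on the open negative half-line reads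
    [- inf I <= -oo]. *)
Lemma ldp_neg (x : R) : x < 0 -> I x = +oo%E.
Proof.
move=> x0; pose neg : set R := [set x | x < 0].
have on : open neg by exact: open_lt.
have [[I0 _] [_ /(_ neg on)]] := ldp.
have -> : limf_einf (fun t : R => (t^-1)%:E *
    elog (P (X t @^-1` neg)))%E (pinfty_nbhs R) = -oo%E.
  rewrite limf_einfE; apply/eqP; rewrite -leeNy_eq; apply: ge_ereal_sup => y [V PV <-].
  have [M [_ HM]] := PV.
  apply: ereal_inf_lbound; exists (Num.max M 0 + 1).
    by apply: HM; rewrite /= ltr_pwDr // le_max lexx.
  have t0 : 0 < Num.max M 0 + 1 by rewrite ltr_wpDl // le_max lexx orbT.
  rewrite (_ : _ @^-1` _ = set0).
    by rewrite measure0 /= eqxx gt0_muleNy // lte_fin invr_gt0.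
  by apply/seteqP; split => // w; rewrite /neg /X /= ltNge divr_ge0 // ltW.
rewrite leeNy_eq eqe_oppLR /= => /eqP Iy.
by apply/eqP; rewrite -leye_eq -Iy; apply: ereal_inf_lbound; exists x.
Qed.

Lemma ldp_mean_ge0 : 0 <= mu.
Proof.
rewrite leNgt; apply/negP => /ldp_neg.
by rewrite (I_eq0 mu).2.
Qed.

(** Any [c] strictly below [r] works: the upper bound places the limsup below [- c], so eventually
    the probability is null or its logarithm is below [- c t]. *)
Lemma ldp_exponential (F : set R) (r : \bar R) : closed F -> (0 < r)%E ->
  (forall x, F x -> (r <= I x)%E) ->
  exists2 c : R, 0 < c & exists2 t0 : R, 0 < t0 & forall t, t0 <= t ->
    pr P (X t @^-1` F) <= expR (- (c * t)).
Proof.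
move=> cF r0 Fr; have [_ [/(_ F cF) H _]] := ldp.
have [c [c0 cr]] : exists c : R, 0 < c /\ (c%:E < r)%E.
  case: r r0 {Fr} => [r| |] //; last by exists 1; rewrite ltry.
  by rewrite lte_fin => r0; exists (r / 2); rewrite lte_fin; split; lra.
have {}H : (limf_esup (fun t : R => (t^-1)%:E *
    elog (P (X t @^-1` F)))%E (pinfty_nbhs R) < (- c)%:E)%E.
  apply: (le_lt_trans H); rewrite EFinN lteN2 (lt_le_trans cr) //.
  by apply: le_ereal_inf_tmp => _ [x Fx <-]; exact: Fr.
exists c => //; move: H; rewrite limf_esupE => /ereal_inf_lt[_ [V [M [_ HM]] <-]] HV.
exists (Num.max M 0 + 1); first by rewrite ltr_wpDl // le_max lexx orbT.
move=> t tM.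
have t0 : 0 < t by rewrite (lt_le_trans _ tM) // ltr_wpDl // le_max lexx orbT.
have {}HV : ((t^-1)%:E * elog (P (X t @^-1` F)) < (- c)%:E)%E.
  apply: le_lt_trans HV; apply: ereal_sup_ubound; exists t => //.
  by apply: HM; rewrite /= (lt_le_trans _ tM) // ltr_pwDr // le_max lexx.
move: HV; have mF : measurable (X t @^-1` F).
  rewrite (_ : _ @^-1` _ = N t @^-1` [set n | F (n%:R / t)]) //.
  by apply: measurable_counting; exact: ltW.
rewrite (prE P mF) /=; case: eqP => [->|/eqP p0]; first by rewrite expR_ge0.
rewrite -EFinM lte_fin ltr_pdivrMl // => Hln.
have pp : 0 < pr P (X t @^-1` F).
  by rewrite lt_neqAle eq_sym p0 pr_ge0.
by rewrite -[leLHS]lnK // ler_expR (le_trans (ltW Hln)) // mulrN mulrC.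
Qed.

Lemma arrival_early (a : R) : mu < a -> exists2 c : R, 0 < c &
  exists2 t0 : R, 0 < t0 & forall t n, t0 <= t -> a * t <= n%:R ->
    pr P [set w | tau n w <= t] <= expR (- (c * t)).
Proof.
move=> mua; have I0 : (0 < I a)%E.
  rewrite lt_neqAle ldp.1.1 andbT; apply/eqP => /esym/I_eq0 amu.
  by move: mua; rewrite amu ltxx.
have [c c0 [t0 t00 H]] := @ldp_exponential [set x | a <= x] _
  (closed_ge (y := a)) I0 (fun x => I_inc (ltW mua)).
exists c => //; exists t0 => // t n tt nt.
have tp : 0 < t by exact: lt_le_trans tt.
apply: le_trans (H t tt); apply: pr_sub.
- exact: measurable_arrival_le.
- rewrite (_ : _ @^-1` _ = N t @^-1` [set n | a <= n%:R / t]) //.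
  by apply: measurable_counting; exact: ltW.
- rewrite arrival_le ?ltW // => w /= nN.
  by rewrite /X ler_pdivlMr // (le_trans nt) // ler_nat.
Qed.

(** The closed half-line below [a] reaches outside [[0, mu]], where [I_dec] is silent; [ldp_neg]
    supplies the bound there. *)
Lemma arrival_late (a : R) : 0 <= a -> a < mu -> exists2 c : R, 0 < c &
  exists2 t0 : R, 0 < t0 & forall t n, t0 <= t -> n%:R <= a * t ->
    pr P [set w | t < tau n w] <= expR (- (c * t)).
Proof.
move=> a0 amu; have I0 : (0 < I a)%E.
  rewrite lt_neqAle ldp.1.1 andbT; apply/eqP => /esym/I_eq0 E.
  by move: amu; rewrite E ltxx.
have Ia x : x <= a -> (I a <= I x)%E.
  move=> xa; have [x0|x0] := leP 0 x; first by apply: I_dec => //; exact: ltW.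
  by rewrite (ldp_neg x0) leey.
have [c c0 [t0 t00 H]] := @ldp_exponential [set x | x <= a] _
  (closed_le (y := a)) I0 Ia.
exists c => //; exists t0 => // t n tt nt.
have tp : 0 < t by exact: lt_le_trans tt.
apply: le_trans (H t tt); apply: pr_sub.
- exact: measurable_arrival_gt.
- rewrite (_ : _ @^-1` _ = N t @^-1` [set n | n%:R / t <= a]) //.
  by apply: measurable_counting; exact: ltW.
- rewrite arrival_gt ?ltW // => w /= nN.
  by rewrite /X ler_pdivrMr // (le_trans _ nt) // ler_nat ltnW.
Qed.

End counting_process.

(** * Arrival events and claims as a past for later claims *)

Section independence.
Context {R : realType} {d : measure_display} {T : measurableType d}.
Variables (P : probability T R) (C tau : nat -> {RV P >-> R}).
Hypothesis ind : claims_indep P (fun i => C i : T -> R) (fun j => tau j : T -> R).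

Definition arrival_box (m : nat) (D : nat -> set R) : set T :=
  \bigcap_(j in `I_m) tau j @^-1` D j.

Lemma measurable_arrival_box m D : (forall j, measurable (D j)) ->
  measurable (arrival_box m D).
Proof. by move=> mD; apply: bigcap_measurableType => j _; exact: measurable_RV. Qed.

Lemma indep_arrival_box n m D : (forall j, measurable (D j)) ->
  indep_claims C 0 n (arrival_box m D).
Proof.
move=> mD; split; first exact: measurable_arrival_box.
move=> A mA; apply: EFin_inj; rewrite setIC EFinM -prodEFin.
have mB : measurable (\bigcap_(l in [set l | (0 <= l < n)%N]) C l @^-1` A l).
  by apply: bigcap_measurableType => j _; exact: measurable_RV.
rewrite -!prE //; last 2 first.
- exact: measurable_arrival_box.
- by apply: measurableI => //; exact: measurable_arrival_box.
rewrite big_mkord muleC.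
transitivity ((\prod_(i < n) P (C i @^-1` A i)) * P (arrival_box m D))%E.
  exact: ind.
congr (_ * _)%E; apply: eq_bigr => i _; rewrite prE //; exact: measurable_RV.
Qed.

(** Both sides of the product formula are additive in the event. It serves for slices between nested
    arrival boxes, which are not boxes themselves. *)
Lemma indep_claimsD i n E F : indep_claims C i n E -> indep_claims C i n F ->
  F `<=` E -> indep_claims C i n (E `\` F).
Proof.
move=> [mE HE] [mF HF] FE; split; first exact: measurableD.
move=> A mA; set B := \bigcap_(_ in _) _.
have mB : measurable B.
  by apply: bigcap_measurableType => j _; exact: measurable_RV.
have -> : (E `\` F) `&` B = (E `&` B) `\` (F `&` B).
  by apply/seteqP; split => w /=; tauto.
rewrite !pr_setD //; try exact: measurableI; last by apply: setSI.
by rewrite HE // HF // mulrBl.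
Qed.

(** Revealing the last claim instead of the first: in the lower bound a large claim is fixed while
    the sums of the claims before it are still to be estimated. *)
Lemma indep_claims_last i n E (D : set R) : (i <= n)%N ->
  indep_claims C i n.+1 E -> measurable D ->
  indep_claims C i n (E `&` C n @^-1` D) /\
  pr P (E `&` C n @^-1` D) = pr P E * pr P (C n @^-1` D).
Proof.
move=> ni [mE H] mD.
have prD : pr P (E `&` C n @^-1` D) = pr P E * pr P (C n @^-1` D).
  by apply: (indep_claims1 (conj mE H)) => //; rewrite ni /=.
split => //; split; first by apply: measurableI => //; exact: measurable_RV.
move=> A mA; rewrite prD.
pose A' l := if l == n then D else A l.
have mA' l : measurable (A' l) by rewrite /A'; case: ifP.
have := H A' mA'; rewrite big_nat_recr //= {3}/A' eqxx.
rewrite (_ : \prod_(i <= l < n) pr P (C l @^-1` A' l) =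
   \prod_(i <= l < n) pr P (C l @^-1` A l)); last first.
  by apply: eq_big_nat => l /andP[_ ln]; rewrite /A' ltn_eqF.
rewrite -mulrA [X in _ = _ * X]mulrC => <-; congr (pr _ _); rewrite -setIA.
congr (_ `&` _); apply/seteqP; split => w.
  move=> [wD wA] l /= /andP[il]; rewrite ltnS /A'; case: eqP => [->//|/eqP nl] ln.
  by apply: wA; rewrite /= il ltn_neqAle nl.
move=> wA; split; first by have := wA n; rewrite /= ni ltnSn /A' eqxx => /(_ isT).
move=> l /= /andP[il ln]; have := wA l; rewrite /= il ltnS (ltnW ln) /A' ltn_eqF //.
exact.
Qed.

End independence.

(** * Shifts of a long tail against exponentials *)

Section exponential_shift.
Context {R : realType}.

Lemma exponential_geometric_sum (c : R) n : 0 < c ->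
  \sum_(k < n) expR (- (c * k%:R)) <= (1 - expR (- c))^-1.
Proof.
move=> c0; have s1 : 0 < 1 - expR (- c) by rewrite subr_gt0 expR_lt1 oppr_lt0.
have -> : \sum_(k < n) expR (- (c * k%:R)) = \sum_(k < n) expR (- c) ^+ k.
  by apply: eq_bigr => k _; rewrite -expRM_natr mulNr.
rewrite -[leRHS]mul1r ler_pdivlMr // mulrC -[X in X * _](opprK) mulNr opprB.
rewrite -subrX1 opprB lerBlDr lerDl exprn_ge0 // expR_ge0.
Qed.

(** Above [X0] each shift by [h] costs at most [1 + eta <= expR eta], by long-tailedness; below [X0]
    the constant [1 / G X0] makes the bound trivial. *)
Lemma subexponential_tail_shift (G : R -> R) (h eta : R) :
  subexponential_tail G -> 0 < h -> 0 < eta ->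
  exists2 D, 1 <= D & forall v k, G (v - k%:R * h) <= D * expR (eta * k%:R) * G v.
Proof.
move=> [Gle G1 G0 Glong _] h0 eta0.
have Gle1 v : G v <= 1.
  by have [v0|/ltW v0] := leP v 0; [rewrite G1 | rewrite -(G1 0) // Gle].
have [X0 H] := Glong h eta eta0.
exists (G X0)^-1; first by rewrite invf_ge1.
move=> v k; elim: k v => [|k IH] v.
  rewrite mul0r subr0 mulr0 expR0 mulr1 ler_peMl ?(ltW (G0 _)) // invf_ge1 //.
have [vX|/ltW Xv] := leP X0 v; last first.
  apply: (le_trans (Gle1 _)).
  apply: (@le_trans _ _ ((G X0)^-1 * expR (eta * k.+1%:R) * G X0)).
    rewrite mulrAC mulVf ?gt_eqF // mul1r -expR0 ler_expR.
    by rewrite mulr_ge0 // ltW.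
  by rewrite ler_wpM2l ?Gle // mulr_ge0 ?expR_ge0 // invr_ge0 ltW.
have -> : v - k.+1%:R * h = (v - h) - k%:R * h by rewrite -natr1; ring.
apply: (le_trans (IH _)).
have -> : eta * k.+1%:R = eta * k%:R + eta by rewrite -natr1; ring.
rewrite expRD mulrA -[leRHS]mulrA; apply: ler_wpM2l.
  by rewrite mulr_ge0 ?expR_ge0 // invr_ge0 ltW.
rewrite (le_trans (H v vX)) // ler_wpM2r ?(ltW (G0 _)) //.
exact: expR_ge1Dx.
Qed.

End exponential_shift.

(** * Upper bound with random arrival times *)

Section ruin_upper.
Context {R : realType} {d : measure_display} {T : measurableType d}.
Variables (P : probability T R) (C tau : nat -> {RV P >-> R}).
Hypothesis ind : claims_indep P (fun i => C i : T -> R) (fun j => tau j : T -> R).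
Hypothesis tau_ge0 : forall n w, 0 <= tau n w.
Variables (B : R -> R) (G : R -> R) (m p nu : R).
Hypothesis CB : forall i x, P [set w | C i w <= x] = (B x)%:E.
Hypothesis m0 : 0 < m.
Hypothesis Gtail : subexponential_tail G.
Hypothesis BG : forall x y, 0 <= x -> x <= y -> (y - x) * (1 - B y) <= m * (G x - G y).
Hypothesis p0 : 0 < p.
Hypothesis nu0 : 0 < nu.
Hypothesis early : exists2 c : R, 0 < c & exists2 t0 : R, 0 < t0 &
  forall t n, t0 <= t -> nu * t <= n%:R -> pr P [set w | tau n w <= t] <= expR (- (c * t)).

Definition ruin_by (u : R) (n : nat) : set T :=
  \bigcup_(l in `I_n.+1) [set w | u + p * tau l w <= \sum_(0 <= j < l) C j w].

Lemma measurable_ruin_by u n : measurable (ruin_by u n).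
Proof.
apply: bigcup_measurable => l _.
rewrite (_ : [set w | _] = setT `&`
   (fun w => \sum_(0 <= j < l) C j w - p * tau l w) @^-1` `[u, +oo[).
  apply: (measurable_funB (measurable_sumC _ _ _)) => //.
  by apply: measurable_funM => //; exact: measurable_funP.
rewrite setTI; apply/seteqP; split => w /=; rewrite in_itv /= andbT lerBrDr //.
Qed.

(** The event that the maximum of [l / nu - tau_l] over [l <= n] is at most [x]. On it the premium
    income is at least the linear drift [p / nu] per claim less [p x]. *)
Let late_box (x : R) n := arrival_box tau n.+1 (fun l => `[l%:R / nu - x, +oo[%classic).

Let late_box_indep x n : indep_claims C 0 n (late_box x n).
Proof. exact: indep_arrival_box. Qed.

Let late_box_sub x y n : x <= y -> late_box x n `<=` late_box y n.
Proof.
move=> xy w H l ln; have := H l ln; rewrite /= !in_itv /= !andbT.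
by apply: le_trans; rewrite lerD2l lerN2.
Qed.

Let late_boxT x n : n%:R / nu <= x -> late_box x n = setT.
Proof.
move=> nx; apply/seteqP; split => // w _ l /= ln; rewrite in_itv /= andbT.
rewrite (le_trans _ (tau_ge0 l w)) // subr_le0 (le_trans _ nx) //.
by rewrite ler_wpM2r ?invr_ge0 ?(ltW nu0) // ler_nat.
Qed.

Let ruin_late_box u x n :
  ruin_by u n `&` late_box x n `<=` drift_crossing C (p / nu) (u - p * x) n.
Proof.
move=> w [[l ln /= H] /(_ l ln)]; rewrite /= in_itv /= andbT => Hl; exists l => //=.
rewrite (le_trans _ H) // -addrA lerD2l.
have : p * (l%:R / nu - x) <= p * tau l w by rewrite ler_pM2l.
have -> : p * (l%:R / nu - x) = - (p * x) + l%:R * (p / nu) by ring.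
exact.
Qed.

(* If [tau_l < l / nu - x] then [l / nu > x] and [tau_l <= l / nu], which is an
   atypical event at a time beyond [x]. *)
Let late_boxC : exists2 c : R, 0 < c & exists2 D : R, 0 < D & exists2 t0 : R, 0 < t0 &
  forall x n, t0 <= x -> pr P (~` late_box x n) <= D * expR (- (c * x)).
Proof.
have [c c0 [t0 t00 H]] := early.
have c20 : 0 < c / 2 by rewrite divr_gt0.
have nu2 : 0 < c / 2 / nu by rewrite divr_gt0.
have s1 : 0 < 1 - expR (- (c / 2 / nu)) by rewrite subr_gt0 expR_lt1 oppr_lt0.
exists (c / 2) => //; exists (1 - expR (- (c / 2 / nu)))^-1; first by rewrite invr_gt0.
exists t0 => // x n tx.
pose F l := if x <= l%:R / nu then [set w | tau l w <= l%:R / nu] else set0.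
have mF l : measurable (F l).
  by rewrite /F; case: ifP => // _; exact: measurable_arrival_le.
apply: (@le_trans _ _ (pr P (\big[setU/set0]_(l < n.+1) F l))).
  apply: pr_sub.
  - by apply: measurableC; exact: (late_box_indep x n).1.
  - exact: bigsetU_measurable.
  - rewrite -bigcup_mkord => w; rewrite /late_box /arrival_box setC_bigcap.
    move=> [l ln]; rewrite /= in_itv /= andbT => /negP; rewrite -ltNge => Hl.
    exists l => //; rewrite /F; case: ifP => [xl /=|/negbT].
      rewrite (le_trans (ltW Hl)) // lerBlDr lerDl.
      by rewrite (le_trans (ltW t00)).
    rewrite -ltNge => lx; have := lt_trans Hl (_ : l%:R / nu - x < 0).
    by rewrite subr_lt0 => /(_ lx); rewrite ltNge tau_ge0.
apply: (le_trans (pr_bigsetU P _ mF)).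
(* As [x <= l / nu], half of the rate yields the decay in [x]; the other half is summed over [l]. *)
apply: (@le_trans _ _ (\sum_(l < n.+1) expR (- (c / 2 * x)) *
    expR (- (c / 2 / nu * l%:R)))).
  apply: ler_sum => l _; rewrite /F; case: ifP => xl; last first.
    by rewrite pr_set0 mulr_ge0 // expR_ge0.
  apply: (le_trans (H _ _ (le_trans tx xl) _)).
    by rewrite mulrC divfK // gt_eqF.
  rewrite -expRD ler_expR.
  have -> : c / 2 / nu * l%:R = c / 2 * (l%:R / nu) by ring.
  have : c / 2 * x <= c / 2 * (l%:R / nu) by rewrite ler_pM2l.
  have -> : c * (l%:R / nu) = c / 2 * (l%:R / nu) + c / 2 * (l%:R / nu).
    by rewrite -mulrDl -splitr.
  by move=> ?; lra.
rewrite -mulr_sumr mulrC ler_wpM2r ?expR_ge0 //.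
exact: exponential_geometric_sum.
Qed.

(* Splits according to the integer part of the delay [x] needed for [late_box x],
   an arrival event of exponentially small complement. *)
Lemma ruin_by_le c : m < p / nu -> m / (p / nu - m) < c ->
  exists u0, forall u n, u0 <= u -> pr P (ruin_by u n) <= c * G u.
Proof.
move=> ma mc; have [h0 h1 h2] := And3 m0 p0 nu0.
have [Gle G1 G0 Glong _] := Gtail.
pose c1 := (m / (p / nu - m) + c) / 2.
have mc1 : m / (p / nu - m) < c1 by rewrite /c1; lra.
have c1c : c1 < c by rewrite /c1; lra.
have c10 : 0 < c1 by apply: lt_trans mc1; rewrite divr_gt0 // subr_gt0.
have [u1 H1] := drift_crossing_prob CB m0 Gtail BG ma mc1.
(* A constant valid at every level: below [u1] its second summand makes the bound at least
   [pr P E]. *)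
pose c' := c1 + (G u1)^-1.
have Gu1 : 0 < (G u1)^-1 by rewrite invr_gt0.
have c'0 : 0 < c' by rewrite addr_gt0.
have H1' v n E : indep_claims C 0 n E ->
    pr P (E `&` drift_crossing C (p / nu) v n) <= c' * G v * pr P E.
  move=> iE; have [v1|/ltW v1] := leP u1 v.
    apply: (le_trans (H1 _ _ _ v1 iE)); rewrite ler_wpM2r ?pr_ge0 //.
    by rewrite ler_wpM2r ?(ltW (G0 _)) // lerDl ltW.
  apply: (@le_trans _ _ (pr P E)).
    apply: pr_sub; [|exact: iE.1|exact: subIsetl].
    by apply: measurableI; [exact: iE.1 | exact: measurable_drift_crossing].
  rewrite ler_peMl ?pr_ge0 // (@le_trans _ _ ((G u1)^-1 * G u1)) //.
    by rewrite mulVf ?gt_eqF.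
  by apply: ler_pM; [exact: ltW | exact: ltW | rewrite /c' lerDr ltW | exact: Gle].
have [g g0 [D D0 [t0 t00 HD]]] := late_boxC.
have g20 : 0 < g / 2 by rewrite divr_gt0.
(* The shifted tail grows at half the rate at which the slices decay, so the sum over the slices
   converges. *)
have [D' D'1 HD'] := subexponential_tail_shift Gtail p0 g20.
pose K := c' * D' * D * expR (g / 2) * (1 - expR (- (g / 2)))^-1.
have s1 : 0 < 1 - expR (- (g / 2)) by rewrite subr_gt0 expR_lt1 oppr_lt0.
have K0 : 0 < K.
  have D'0 : 0 < D' by lra.
  by rewrite !mulr_gt0 ?invr_gt0 // expR_gt0.
pose e := (c - c1) / 2.
have e0 : 0 < e by rewrite divr_gt0 // subr_gt0.
(* [t0] makes [late_boxC] applicable; the other summand gives [K expR (- (g A)) <= e] through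
   [1 + x <= expR x]. *)
pose A := t0 + K / e / g.
have At0 : t0 <= A by rewrite lerDl; apply/ltW/divr_gt0/g0; exact: divr_gt0.
have KA : K * expR (- (g * A)) <= e.
  rewrite expRN ler_pdivrMr ?expR_gt0 //.
  have : K / e <= expR (g * A).
    rewrite (le_trans _ (expR_ge1Dx _)) // /A mulrDr mulrCA mulfV ?gt_eqF // mulr1.
    have : 0 < g * t0 by rewrite mulr_gt0.
    by lra.
  by rewrite ler_pdivrMr // mulrC.
have [u2 H2] := Glong (p * A) (c / (c1 + e) - 1)
  ltac:(by rewrite subr_gt0 ltr_pdivlMr ?mul1r /e; lra).
exists (Num.max u2 (u1 + p * A)) => u n; rewrite ge_max => /andP[uu2 uu1].
pose v := u - p * A.
have v1 : u1 <= v by rewrite lerBrDr.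
pose E k := late_box (A + k.+1%:R) n `\` late_box (A + k%:R) n.
have Akk k : A + k%:R <= A + k.+1%:R by rewrite lerD2l ler_nat.
have iE k : indep_claims C 0 n (E k).
  by apply: indep_claimsD => //; exact: late_box_sub.
have mE k : measurable (E k) := (iE k).1.
have mL x : measurable (late_box x n) := (late_box_indep x n).1.
have mr : measurable (ruin_by u n) by exact: measurable_ruin_by.
have key M : pr P (ruin_by u n `&` late_box (A + M%:R) n) <=
    c1 * G v + \sum_(k < M) c' * G (v - k.+1%:R * p) * pr P (E k).
  elim: M => [|M IH].
    rewrite big_ord0 !addr0.
    apply: (@le_trans _ _ (pr P (late_box A n `&` drift_crossing C (p / nu) v n))).
      apply: pr_sub; try (apply: measurableI => //).
        exact: measurable_drift_crossing.
      by move=> w H; split; [case: H | exact: ruin_late_box H].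
    apply: (le_trans (H1 _ _ _ v1 (late_box_indep A n))).
    by rewrite ler_piMr ?pr_le1 // mulr_ge0 // ltW.
  rewrite big_ord_recr /= addrA.
  apply: (@le_trans _ _ (pr P (ruin_by u n `&` late_box (A + M%:R) n) +
       pr P (E M `&` drift_crossing C (p / nu) (v - M.+1%:R * p) n))).
    have mX := measurableI _ _ mr (mL (A + M%:R)).
    have mY := measurableI _ _ (mE M)
      (measurable_drift_crossing C (p / nu) (v - M.+1%:R * p) n).
    apply: le_trans (pr_setU P mX mY); apply: pr_sub; first exact: measurableI.
      exact: measurableU.
    move=> w H; have [HL|HL] := pselect (late_box (A + M%:R) n w).
      by left; split => //; case: H.
    right; split; first by split => //; case: H.
    have -> : v - M.+1%:R * p = u - p * (A + M.+1%:R) by rewrite /v; ring.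
    exact: ruin_late_box H.
  by apply: lerD => //; exact: H1'.
have prEk k : pr P (E k) <= D * expR (- (g * (A + k%:R))).
  apply: le_trans (HD _ n _); last by rewrite (le_trans At0) // lerDl.
  by apply: pr_sub => //; [exact: measurableC | move=> w []].
(* For fixed [n], finitely many slices exhaust the space, by [late_boxT]. *)
have [M HM] : exists M : nat, n%:R / nu <= A + M%:R.
  exists (Num.bound (n%:R / nu)).
  rewrite (le_trans (ltW (archi_boundP _))) ?divr_ge0 ?(ltW nu0) //.
  by rewrite lerDr (le_trans (ltW t00)).
have := key M; rewrite late_boxT // setIT => /le_trans; apply.
have Gv : 0 < G v by [].
have sumb : \sum_(k < M) c' * G (v - k.+1%:R * p) * pr P (E k) <= e * G v.
  apply: (@le_trans _ _ (\sum_(k < M) c' * D' * D * expR (g / 2) *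
     expR (- (g * A)) * G v * expR (- (g / 2 * k%:R)))).
    apply: ler_sum => k _.
    have -> : c' * D' * D * expR (g / 2) * expR (- (g * A)) * G v *
        expR (- (g / 2 * k%:R)) =
      c' * (D' * expR (g / 2 * k.+1%:R) * G v) * (D * expR (- (g * (A + k%:R)))).
      have -> : expR (g / 2 * k.+1%:R) = expR (g / 2) * expR (g / 2 * k%:R).
        by rewrite -expRD -natr1; congr expR; ring.
      have -> : expR (- (g * (A + k%:R))) =
        expR (- (g * A)) * expR (- (g / 2 * k%:R)) * expR (- (g / 2 * k%:R)).
        by rewrite -!expRD; congr expR; field.
      transitivity (c' * D' * D * expR (g / 2) * expR (- (g * A)) * G v *
        expR (- (g / 2 * k%:R)) * (expR (g / 2 * k%:R) * expR (- (g / 2 * k%:R)))).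
        by rewrite -expRD subrr expR0 mulr1.
      by ring.
    apply: ler_pM; rewrite ?pr_ge0 ?mulr_ge0 ?(ltW (G0 _)) ?(ltW c'0) //.
    by rewrite ler_pM2l.
  rewrite -mulr_sumr.
  apply: (@le_trans _ _ (c' * D' * D * expR (g / 2) * expR (- (g * A)) * G v *
     (1 - expR (- (g / 2)))^-1)).
    apply: ler_wpM2l; last exact: exponential_geometric_sum.
    have D'0 : 0 < D' by lra.
    by rewrite !mulr_ge0 ?expR_ge0 // ltW.
  have -> : c' * D' * D * expR (g / 2) * expR (- (g * A)) * G v *
     (1 - expR (- (g / 2)))^-1 = K * expR (- (g * A)) * G v by rewrite /K; ring.
  by rewrite ler_pM2r.
apply: (@le_trans _ _ ((c1 + e) * G v)); first by rewrite mulrDl lerD2l.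
have ce0 : 0 < c1 + e by rewrite addr_gt0.
have := H2 u uu2; rewrite -/v => /(ler_wpM2l (ltW ce0)) /le_trans; apply.
rewrite mulrA (_ : (c1 + e) * (1 + (c / (c1 + e) - 1)) = c) //.
by rewrite [1 + _]addrC subrK mulrC divfK // gt_eqF.
Qed.

End ruin_upper.

(** * Lower deviations of the claim sums *)

Section lower_deviation.
Context {R : realType} {d : measure_display} {T : measurableType d}.
Variables (P : probability T R) (C : nat -> {RV P >-> R}) (B G : R -> R) (m : R).
Hypothesis C0 : forall i w, 0 <= C i w.
Hypothesis CB : forall i x, P [set w | C i w <= x] = (B x)%:E.

Definition low_sum (i n : nat) (x : R) : set T :=
  [set w | \sum_(i <= j < i + n) C j w <= x].

Lemma measurable_low_sum i n x : measurable (low_sum i n x).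
Proof.
rewrite (_ : low_sum i n x = setT `&`
   (fun w => \sum_(i <= j < i + n) C j w) @^-1` `]-oo, x]).
  by apply: measurable_sumC.
by rewrite setTI; apply/seteqP; split => w /=; rewrite in_itv.
Qed.

(* Laplace transform of the claims rounded down to the lattice and capped at
   [K.-1 * h]; an upper bound for that of the claims themselves. *)
Definition binned_laplace (h theta : R) (K : nat) : R :=
  \sum_(j < K) (claim_tail B h j - claim_tail B h j.+1) * expR (- (theta * (j.-1%:R * h)))
  + claim_tail B h K * expR (- (theta * (K.-1%:R * h))).

(** Chernoff's bound by peeling off claims: on each bin the claim is replaced by its lower endpoint,
    and the remaining sum is bounded by induction. An empty sum is at most [x] only if [x >= 0],
    where the exponential is at least [1]. *)
Lemma low_sum_chernoff h theta K n i x E : 0 < h -> 0 < theta -> (0 < K)%N ->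
  indep_claims C i (i + n) E ->
  pr P (E `&` low_sum i n x) <= expR (theta * x) * binned_laplace h theta K ^+ n * pr P E.
Proof.
move=> h0 theta0 K0; set lambda := binned_laplace h theta K.
elim: n i x E => [|n IH] i x E indE; have mE := indE.1.
  rewrite expr0 mulr1; have [x0|x0] := leP 0 x.
    apply: (@le_trans _ _ (pr P E)).
      by apply: pr_sub => //; apply: measurableI => //; exact: measurable_low_sum.
    by rewrite ler_peMl ?pr_ge0 // -expR0 ler_expR mulr_ge0 // ltW.
  rewrite (_ : E `&` _ = set0) ?pr_set0 ?mulr_ge0 ?expR_ge0 ?pr_ge0 //.
  apply/seteqP; split => // w [_]; rewrite /low_sum /= addn0 big_geq //.
  by rewrite leNgt x0.
have ml k y : measurable (low_sum k n y) by exact: measurable_low_sum.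
pose F j := E `&` C i @^-1` claim_bin h j.
have iN : (i < i + n.+1)%N by lia.
have mF j : measurable (F j).
  by apply: measurableI => //; apply: measurable_RV; exact: measurable_claim_bin.
pose H := E `&` C i @^-1` `]K.-1%:R * h, +oo[%classic.
have mH : measurable H by apply: measurableI => //; exact: measurable_RV.
have HF j : indep_claims C i.+1 (i.+1 + n) (F j).
  rewrite addSnnS; apply: indep_claimsS => //; exact: measurable_claim_bin.
have HH : indep_claims C i.+1 (i.+1 + n) H.
  by rewrite addSnnS; apply: indep_claimsS.
have prF j : pr P (F j) = pr P E * (claim_tail B h j - claim_tail B h j.+1).
  rewrite (indep_claims1 indE) ?leqnn //; last exact: measurable_claim_bin.
  by rewrite (pr_claim_bin CB) // ltW.
have prH : pr P H = pr P E * claim_tail B h K.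
  by rewrite (indep_claims1 indE) ?leqnn // (pr_claim_gt CB); case: (K) K0.
pose Fl j := F j `&` low_sum i.+1 n (x - j.-1%:R * h).
pose Hl := H `&` low_sum i.+1 n (x - K.-1%:R * h).
have mFl j : measurable (Fl j) by exact: measurableI.
have mHl : measurable Hl by exact: measurableI.
have sumE w : \sum_(i <= j < i + n.+1) C j w =
    C i w + \sum_(i.+1 <= j < i.+1 + n) C j w.
  by rewrite big_ltn // addSnnS.
have step : pr P (E `&` low_sum i n.+1 x) <= \sum_(j < K) pr P (Fl j) + pr P Hl.
  apply: (@le_trans _ _ (pr P (\big[setU/set0]_(j < K) Fl j `|` Hl))).
    apply: pr_sub.
    - by apply: measurableI => //; exact: measurable_low_sum.
    - by apply: measurableU => //; apply: bigsetU_measurable.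
    move=> w [Ew]; rewrite /low_sum /= sumE => Hx.
    have [wK|wK] := leP (C i w) (K.-1%:R * h).
      have [j jK jw] := claim_bin_cover wK; left.
      rewrite -bigcup_mkord; exists j; first by rewrite /= -(prednK K0).
      split => //; rewrite /low_sum /= lerBrDr (le_trans _ Hx) // addrC lerD2r.
      case: j jw {jK} => [|j]; first by rewrite mul0r.
      by rewrite /= in_itv /= => /andP[/ltW].
    right; split; first by split => //=; rewrite in_itv /= wK.
    by rewrite /low_sum /= lerBrDr (le_trans _ Hx) // addrC lerD2r ltW.
  apply: (le_trans (pr_setU P _ mHl)); first exact: bigsetU_measurable.
  by rewrite lerD2r; exact: (pr_bigsetU P _ mFl).
apply: (le_trans step).
have -> : expR (theta * x) * lambda ^+ n.+1 * pr P E =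
  \sum_(j < K) expR (theta * (x - j.-1%:R * h)) * lambda ^+ n * pr P (F j) +
  expR (theta * (x - K.-1%:R * h)) * lambda ^+ n * pr P H.
  rewrite exprS {1}/lambda /binned_laplace prH.
  transitivity (expR (theta * x) * lambda ^+ n * pr P E *
    \sum_(j < K) (claim_tail B h j - claim_tail B h j.+1) *
        expR (- (theta * (j.-1%:R * h))) +
    expR (theta * x) * lambda ^+ n * pr P E *
      (claim_tail B h K * expR (- (theta * (K.-1%:R * h))))); first by ring.
  rewrite mulr_sumr; congr (_ + _); last by rewrite mulrBr expRD; ring.
  by apply: eq_bigr => j _; rewrite prF mulrBr expRD; ring.
apply: lerD; last exact: IH.
by apply: ler_sum => j _; exact: IH.
Qed.

Hypothesis m0 : 0 < m.
Hypothesis GB : forall x y, 0 <= x -> x <= y -> m * (G x - G y) <= (y - x) * (1 - B x).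
Hypothesis G01 : G 0 = 1.
Hypothesis Gy : forall e, 0 < e -> exists x0, forall x, x0 <= x -> G x <= e.

(** The right side is the mean of the binned claims. Telescoping [GB] bounds it below by
    [m (G h - G ((K + 1) h))], and both the mesh and the cap lose at most [(m - b) / 3]. *)
Let binned_mean b : b < m -> exists h K, 0 < h /\
  b < h * \sum_(j < K) (1 - B (j.+1%:R * h)).
Proof.
move=> bm; have m00 := m0; pose h := (m - b) / 3.
have h0 : 0 < h by rewrite divr_gt0 // subr_gt0.
have e0 : 0 < (m - b) / 3 / m by rewrite !divr_gt0 // subr_gt0.
have [x0 Hx0] := Gy e0; pose K := Num.bound (`|x0| / h).
have xK : x0 <= K.+1%:R * h.
  rewrite (le_trans (ler_norm _)) // -ler_pdivrMr //.
  have := archi_boundP (divr_ge0 (normr_ge0 x0) (ltW h0)).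
  by move=> /ltW /le_trans; apply; rewrite ler_nat.
exists h, K; split => //.
have step j : m * (G (j%:R * h) - G (j.+1%:R * h)) <= h * (1 - B (j%:R * h)).
  have := @GB (j%:R * h) (j.+1%:R * h).
  have -> : j.+1%:R * h - j%:R * h = h by rewrite -natr1; ring.
  apply; first by rewrite mulr_ge0 // ltW.
  by rewrite ler_wpM2r ?(ltW h0) // ler_nat.
have tel n : m * (G h - G (n.+1%:R * h)) <= h * \sum_(j < n) (1 - B (j.+1%:R * h)).
  elim: n => [|n IH]; first by rewrite big_ord0 mul1r subrr !mulr0.
  rewrite big_ord_recr /= [leRHS]mulrDr (le_trans _ (lerD IH (step n.+1))) //.
  by rewrite -mulrDr addrA subrK.
apply: lt_le_trans (tel K).
have := step 0%N; rewrite mul0r mul1r G01 => H1.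
have H2 : m * G (K.+1%:R * h) <= (m - b) / 3.
  by rewrite mulrC -ler_pdivlMr // Hx0.
have B0 : 0 <= B 0 by exact: claim_df_ge0 CB 0.
have : h * (1 - B 0) <= h by rewrite ler_piMr ?(ltW h0) //; lra.
rewrite /h in H1 *; rewrite mulrBr; lra.
Qed.

Lemma low_sum_le b : 0 < b -> b < m -> exists2 theta : R, 0 < theta &
  forall n i x E, indep_claims C i (i + n) E ->
    pr P (E `&` low_sum i n (n%:R * b - x)) <= expR (- (theta * x)) * pr P E.
Proof.
move=> b0 bm; have [h [K [h0 Hb]]] := binned_mean bm.
set S := \sum_(j < K) _ in Hb; set M := h * S in Hb.
have M0 : 0 < M by exact: lt_trans Hb.
pose k := K.+1%:R * h; have k0 : 0 < k by rewrite mulr_gt0.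
(* The solution of [M (1 - theta k) = b], which makes the transform at most [1 - theta M expR (-
   (theta k)) <= 1 - theta b]. *)
pose theta := (M - b) / (M * k).
have theta0 : 0 < theta by rewrite divr_gt0 ?subr_gt0 // mulr_gt0.
exists theta => // n i x E indE.
have := @low_sum_chernoff h theta K.+1 n i (n%:R * b - x) E h0 theta0 isT indE.
move=> /le_trans; apply; rewrite ler_wpM2r ?pr_ge0 //.
have lam0 : 0 <= binned_laplace h theta K.+1.
  apply: addr_ge0; last first.
    by rewrite mulr_ge0 ?expR_ge0 //= subr_ge0 (claim_df_le1 CB).
  apply: sumr_ge0 => j _; rewrite mulr_ge0 ?expR_ge0 //.
  by rewrite -(pr_claim_bin CB 0) ?pr_ge0 // ltW.
have lam : binned_laplace h theta K.+1 <= expR (- (theta * b)).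
  apply: (@le_trans _ _ (1 - theta * b)); last first.
    exact: expR_ge1Dx.
  (* Summation by parts brings in the tails; each decrement of the exponential is at least
     [theta h expR (- (theta k))], which leaves the mean [M] as a factor. *)
  rewrite /binned_laplace (abel_sum (claim_tail B h)
    (fun j => expR (- (theta * (j.-1%:R * h))))) /=.
  rewrite mul0r mulr0 oppr0 expR0 mulr1 big_ord_recl /= mul0r mulr0 oppr0 expR0.
  rewrite subrr mulr0 add0r lerD2l.
  have : \sum_(j < K) (1 - B (j.+1%:R * h)) * (theta * h * expR (- (theta * k))) <=
      \sum_(j < K) - ((1 - B ((bump 0 j)%:R * h)) *
       (expR (- (theta * ((bump 0 j)%:R * h))) -
          expR (- (theta * ((bump 0 j).-1%:R * h))))).
    apply: ler_sum => j _; rewrite /bump /= add1n /= -[leRHS]mulrN opprB.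
    apply: ler_wpM2l; first by rewrite subr_ge0 (claim_df_le1 CB).
    have jk : j.+1%:R * h <= k.
      by rewrite ler_wpM2r ?(ltW h0) // ler_nat ltnS ltnW.
    apply: (@le_trans _ _ (theta * h * expR (- (theta * (j.+1%:R * h))))).
      apply: ler_wpM2l; first by rewrite mulr_ge0 // ltW.
      by rewrite ler_expR lerN2 ler_wpM2l // ltW.
    have -> : expR (- (theta * (j%:R * h))) =
        expR (theta * h) * expR (- (theta * (j.+1%:R * h))).
      by rewrite -expRD -natr1; congr expR; ring.
    rewrite -[X in _ <= _ - X]mul1r -mulrBl ler_wpM2r ?expR_ge0 //.
    by rewrite lerBrDl expR_ge1Dx.
  rewrite sumrN -mulr_suml -/S => H.
  rewrite -lerN2 opprK (le_trans _ H) //.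
  have -> : S * (theta * h * expR (- (theta * k))) = theta * (M * expR (- (theta * k))).
    by rewrite /M; ring.
  rewrite ler_pM2l //.
  have : M * (1 - theta * k) <= M * expR (- (theta * k)).
    by rewrite ler_pM2l // expR_ge1Dx.
  have : M * (theta * k) = M - b by rewrite /theta; field; rewrite !gt_eqF.
  by move=> ? ?; lra.
have H1 : binned_laplace h theta K.+1 ^+ n <= expR (- (theta * b)) ^+ n.
  by apply: lerXn2r; rewrite ?nnegrE ?expR_ge0.
rewrite (le_trans (ler_wpM2l (expR_ge0 _) H1)) // -expRM_natr -expRD ler_expR.
by rewrite le_eqVlt; apply/orP; left; apply/eqP; ring.
Qed.

End lower_deviation.

(** * Lower bound by a single large claim *)

Section ruin_lower.
Context {R : realType} {d : measure_display} {T : measurableType d}.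
Variables (P : probability T R) (C tau : nat -> {RV P >-> R}).
Hypothesis ind : claims_indep P (fun i => C i : T -> R) (fun j => tau j : T -> R).
Variables (B : R -> R) (G : R -> R) (m p nu b : R).
Hypothesis C0 : forall i w, 0 <= C i w.
Hypothesis CB : forall i x, P [set w | C i w <= x] = (B x)%:E.
Hypothesis m0 : 0 < m.
Hypothesis Gtail : subexponential_tail G.
Hypothesis BG : forall x y, 0 <= x -> x <= y -> (y - x) * (1 - B y) <= m * (G x - G y).
Hypothesis GB : forall x y, 0 <= x -> x <= y -> m * (G x - G y) <= (y - x) * (1 - B x).
Hypothesis Gy : forall e, 0 < e -> exists x0, forall x, x0 <= x -> G x <= e.
Hypothesis p0 : 0 < p.
Hypothesis nu0 : 0 < nu.
Hypothesis b0 : 0 < b.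
Hypothesis bm : b < m.
Hypothesis late : exists2 c : R, 0 < c & exists2 t0 : R, 0 < t0 &
  forall t n, t0 <= t -> n%:R <= nu * t -> pr P [set w | t < tau n w] <= expR (- (c * t)).

Let big_claim (c : nat -> R) l : set T := C l @^-1` `]c l, +oo[%classic.

Let mbig c l : measurable (big_claim c l).
Proof. exact: measurable_RV. Qed.

Let pr_big c l : pr P (big_claim c l) = 1 - B (c l).
Proof. exact: pr_claim_gt CB l _. Qed.

Let setT_box n : indep_claims C 0 n setT.
Proof.
have -> : [set: T] = arrival_box tau 0 (fun=> setT) by apply/seteqP; split.
exact: indep_arrival_box.
Qed.

Let big_indep c l : indep_claims C 0 l (big_claim c l).
Proof.
rewrite -[big_claim c l]setTI.
by have [] := indep_claims_last (leq0n l) (setT_box l.+1) (measurable_itv `]c l, +oo[).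
Qed.

(** A Bonferroni bound: [E l] without the earlier large claims is disjoint from the earlier [E k],
    and by independence the removed part has probability at most the total of the large claims times
    that of the [l]-th. *)
Let big_disjoint (E : nat -> set T) (c : nat -> R) M :
  (forall l, measurable (E l)) -> (forall l, E l `<=` big_claim c l) ->
  \sum_(l < M) (pr P (E l) -
     (\sum_(k < M) pr P (big_claim c k)) * pr P (big_claim c l)) <=
  pr P (\big[setU/set0]_(l < M) E l).
Proof.
move=> mE EF; set Phi := \sum_(k < M) pr P (big_claim c k).
suff : forall n, (n <= M)%N -> \sum_(l < n) (pr P (E l) - Phi * pr P (big_claim c l)) <=
  pr P (\big[setU/set0]_(l < n) E l) by move=> /(_ M (leqnn M)).
elim=> [|n IH] nM; first by rewrite !big_ord0 pr_set0.
rewrite !big_ord_recr /=.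
pose U := \big[setU/set0]_(k < n) big_claim c k.
have mU : measurable U by exact: bigsetU_measurable.
have mEn : measurable (\big[setU/set0]_(l < n) E l) by exact: bigsetU_measurable.
apply: (@le_trans _ _ (pr P (\big[setU/set0]_(l < n) E l) + pr P (E n `\` U))).
  apply: lerD; first exact: IH (ltnW nM).
  have -> : E n `\` U = E n `\` (E n `&` U).
    by apply/seteqP; split => w /=; tauto.
  rewrite pr_setD //; last exact: measurableI.
  rewrite lerD2l lerN2.
  apply: (@le_trans _ _ (pr P (\big[setU/set0]_(k < n) (big_claim c n `&` big_claim c k)))).
    apply: pr_sub; first exact: measurableI.
      by apply: bigsetU_measurable => k _; exact: measurableI.
    move=> w [/EF Enw]; rewrite /U -bigcup_mkord => -[k kn Hk].
    rewrite -(bigcup_mkord n (fun k => big_claim c n `&` big_claim c k)).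
    by exists k.
  apply: (@le_trans _ _ (\sum_(k < n) pr P (big_claim c n `&` big_claim c k))).
    apply: (pr_bigsetU P (F := fun k => big_claim c n `&` big_claim c k)).
    by move=> k; exact: measurableI.
  apply: (@le_trans _ _ ((\sum_(k < n) pr P (big_claim c k)) * pr P (big_claim c n))).
    rewrite mulr_suml; apply: ler_sum => k _.
    by rewrite (indep_claims1 (big_indep c n)) //= mulrC.
  rewrite ler_wpM2r ?pr_ge0 // /Phi.
  rewrite -(big_mkord xpredT (fun k => pr P (big_claim c k))).
  rewrite -[leRHS](big_mkord xpredT (fun k => pr P (big_claim c k))).
  rewrite [leRHS](big_cat_nat (n := n)) ?(ltnW nM) //= lerDl.
  by apply: sumr_ge0 => k _; exact: pr_ge0.
rewrite -pr_disjointU //; last 2 first.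
- exact: measurableD.
- move=> w Ew [_]; apply; move: Ew; rewrite /U -!bigcup_mkord => -[k kn /EF Hk].
  by exists k.
apply: pr_sub; [by apply: measurableU => //; exact: measurableD|exact: measurableU|].
by move=> w [|[]]; [left|right].
Qed.

Lemma ruin_by_ge c : b < p / nu -> 0 < c -> c < m / (p / nu - b) ->
  exists u0, forall u, u0 <= u -> exists n, c * G u <= pr P (ruin_by C tau p u n).
Proof.
move=> ba c0 cm; have [h0 h1 h2] := And3 m0 p0 nu0; have [h3 h4] := (b0, bm).
have [Gle G1 G0 Glong _] := Gtail.
pose s := p / nu - b; have s0 : 0 < s by rewrite subr_gt0.
have cs : c * s < m by rewrite -ltr_pdivlMr.
(* Two units of [de] pay for [Late] and [Low], one for the overlaps, one for stopping at [M], one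
   for the shift by [D]. *)
pose de := (1 - c * s / m) / 5.
have csm0 : 0 < c * s / m by rewrite divr_gt0 // mulr_gt0.
have csm1 : c * s / m < 1 by rewrite ltr_pdivrMr // mul1r.
have de0 : 0 < de by rewrite /de; lra.
have de1 : de < 1 / 5 by rewrite /de; lra.
have deE : c * s = (1 - 5 * de) * m by rewrite /de; field; rewrite gt_eqF.
have [g g0 [t0 t00 Hlate]] := late.
have G00 : G 0 = 1 by rewrite G1.
have [theta theta0 Hlow] := low_sum_le C0 CB m0 GB G00 Gy b0 bm.
have exp_small y : 0 < y -> exists2 x, 0 <= x & expR (- (y * x)) <= de.
  move=> y0; exists ((de * y)^-1); first by rewrite invr_ge0 mulr_ge0 // ltW.
  rewrite expRN invf_ple ?posrE ?expR_gt0 //.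
  have -> : y * (de * y)^-1 = de^-1 by rewrite invrM ?unitfE ?gt_eqF // mulVKf ?gt_eqF.
  by rewrite (le_trans _ (expR_ge1Dx _)) // lerDr.
have [A1 A10 HA1] := exp_small g g0; have [A' A'0 HA'] := exp_small theta theta0.
pose A := A1 + t0.
have At0 : t0 <= A by rewrite lerDr.
have A0 : 0 <= A by rewrite addr_ge0 // ltW.
(* All offsets together: the premium up to time [1 / nu + A] and the deficit [A'] of the claim sums.
   A claim above [u + D + l s] then causes ruin. *)
pose D := p / nu + p * A + A'.
have D0 : 0 < D by rewrite ltr_wpDr // ltr_wpDr ?divr_gt0 // mulr_ge0 // ltW.
have sD : s <= D.
  have : 0 <= p * A by rewrite mulr_ge0 // ltW.
  by rewrite /s /D; lra.
have dsm : 0 < de * s / m by rewrite divr_gt0 // mulr_gt0.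
have [u1 Hu1] := Gy dsm.
have [u2 Hu2] := Glong D de de0.
exists (`|u1| + `|u2|) => u uu.
have [n1 n2] := (normr_ge0 u1, normr_ge0 u2).
have [l1 l2] := (ler_norm u1, ler_norm u2).
have u0 : 0 <= u by lra.
have {}Hu1 : G u <= de * s / m by apply: Hu1; lra.
have {}Hu2 : G u <= (1 + de) * G (u + D).
  by have := Hu2 (u + D) ltac:(lra); rewrite addrK.
pose cl (l : nat) := u + D + l%:R * s.
have cl0 l : 0 <= cl l by rewrite addr_ge0 ?mulr_ge0 ?(ltW s0) // addr_ge0 // ltW.
have clS l : cl l.+1 - cl l = s by rewrite /cl -natr1; ring.
have clle l : cl l <= cl l.+1 by rewrite -subr_ge0 clS ltW.
pose f l := 1 - B (cl l).
have fge l : m * (G (cl l) - G (cl l.+1)) <= s * f l.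
  by rewrite -(clS l); exact: GB.
have fsum_ge M : m * (G (cl 0%N) - G (cl M)) <= s * \sum_(l < M) f l.
  elim: M => [|M IH]; first by rewrite big_ord0 subrr !mulr0.
  rewrite big_ord_recr /= [leRHS]mulrDr (le_trans _ (lerD IH (fge M))) //.
  by rewrite -mulrDr addrA subrK.
(* [BG] is applied on the cells ending at the points [cl l]; as [s <= D], the first cell starts
   above [u]. *)
have fsum_le M : s * \sum_(l < M) f l <= m * G u.
  suff : s * \sum_(l < M) f l <= m * (G u - G (cl M - s)).
    move=> /le_trans; apply; rewrite ler_pM2l // gerBl ltW //.
  elim: M => [|M IH].
    rewrite big_ord0 mulr0 mulr_ge0 ?(ltW h0) // subr_ge0 Gle //.
    by rewrite /cl mul0r addr0; lra.
  have H : s * f M <= m * (G (cl M - s) - G (cl M)).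
    have := @BG (cl M - s) (cl M); rewrite subKr; apply; last first.
      by rewrite gerBl ltW.
    rewrite subr_ge0 (le_trans sD) // /cl -addrA addrCA lerDl addr_ge0 //.
    by rewrite mulr_ge0 // ltW.
  rewrite big_ord_recr /= [leLHS]mulrDr (le_trans (lerD IH H)) //.
  by rewrite -mulrDr addrA subrK -(clS M) opprB [_ + (cl M - _)]addrC subrK.
(* Claims are numbered from [0], so claim [l] comes with arrival [l + 1]. *)
pose tl (l : nat) := l.+1%:R / nu + A.
pose Late l := [set w | tl l < tau l.+1 w].
pose Low l := low_sum C 0 l (l%:R * b - A').
pose F l := big_claim cl l.
pose E l := F l `\` (F l `&` Late l `|` F l `&` Low l).
have mLate l : measurable (Late l) by exact: measurable_arrival_gt.
have mLow l : measurable (Low l) by exact: measurable_low_sum.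
have mF l : measurable (F l) by exact: mbig.
have mE l : measurable (E l).
  by apply: measurableD => //; apply: measurableU; exact: measurableI.
have prF l : pr P (F l) = f l by rewrite /F pr_big.
have f0 l : 0 <= f l by rewrite -prF pr_ge0.
have prLate l : pr P (F l `&` Late l) <= de * f l.
  pose Db j : set R := if j == l.+1 then `]tl l, +oo[%classic else setT.
  have mDb j : measurable (Db j) by rewrite /Db; case: ifP.
  have box : Late l = arrival_box tau l.+2 Db.
    apply/seteqP; split => w.
      move=> H j _ /=; rewrite /Db; case: eqP => // ->.
      by rewrite /= in_itv /= andbT.
    move=> /(_ l.+1 (ltnSn _)); rewrite /= /Db eqxx /= in_itv /= andbT.
    exact.
  have [_ ] := indep_claims_last (leq0n l) (indep_arrival_box ind l.+1 l.+2 mDb)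
    (measurable_itv `]cl l, +oo[).
  rewrite -box setIC -/(big_claim cl l) -/(F l) prF => ->.
  rewrite ler_wpM2r // (le_trans _ HA1) // (le_trans (Hlate _ _ _ _)) //.
  - by rewrite (le_trans At0) // /tl lerDr divr_ge0 // ltW.
  - by rewrite /tl mulrDr mulrCA mulfV ?gt_eqF // mulr1 lerDl mulr_ge0 // ltW.
  - rewrite ler_expR lerN2 ler_pM2l // /tl /A addrCA lerDl.
    by rewrite addr_ge0 ?(ltW t00) // divr_ge0 // ltW.
have prLow l : pr P (F l `&` Low l) <= de * f l.
  rewrite -prF (le_trans (Hlow l 0%N A' (F l) _)) ?add0n //.
    exact: big_indep.
  by rewrite ler_wpM2r // pr_ge0.
have prEl l : (1 - 2 * de) * f l <= pr P (E l).
  rewrite /E pr_setD //; last 2 first.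
  - by apply: measurableU; exact: measurableI.
  - by move=> w [[]|[]].
  have := pr_setU P (measurableI _ _ (mF l) (mLate l)) (measurableI _ _ (mF l) (mLow l)).
  by have := prLate l; have := prLow l; rewrite prF; lra.
have EF l : E l `<=` F l by move=> w [].
have [M HM] : exists M, G (cl M) <= de * G (cl 0%N).
  have [x0 Hx0] := Gy (mulr_gt0 de0 (G0 (cl 0%N))).
  exists (Num.bound (`|x0| / s)); apply: Hx0.
  have uD : 0 <= u + D by rewrite addr_ge0 // ltW.
  rewrite (le_trans (ler_norm _)) // /cl ler_wpDl // -ler_pdivrMr //.
  by apply/ltW/archi_boundP; rewrite divr_ge0 // ltW.
exists M; have := big_disjoint M mE EF.
have -> : \sum_(k < M) pr P (big_claim cl k) = \sum_(k < M) f k.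
  by apply: eq_bigr => k _; rewrite pr_big.
set Phi := \sum_(k < M) f k => Hdis.
have Phi_ge0 : 0 <= Phi by apply: sumr_ge0.
have Phile : Phi <= de.
  have := fsum_le M; rewrite -/Phi => H.
  rewrite -(ler_pM2l s0) (le_trans H) //.
  have -> : s * de = m * (de * s / m) by field; rewrite gt_eqF.
  by rewrite ler_pM2l.
have Hsum : (1 - 3 * de) * Phi <= pr P (\big[setU/set0]_(l < M) E l).
  apply: le_trans Hdis; rewrite mulr_sumr; apply: ler_sum => l _.
  have : Phi * pr P (big_claim cl l) <= de * f l.
    by rewrite pr_big -/(f l) ler_wpM2r.
  by have := prEl l; lra.
apply: (@le_trans _ _ (pr P (\big[setU/set0]_(l < M) E l))); last first.
  apply: pr_sub; [exact: bigsetU_measurable | exact: measurable_ruin_by|].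
  rewrite -bigcup_mkord => w [l lM [Fl NL]]; exists l.+1 => //=.
  have NLate : tau l.+1 w <= tl l.
    by rewrite leNgt; apply/negP => H; apply: NL; left.
  have NLow : l%:R * b - A' <= \sum_(0 <= j < l) C j w.
    rewrite ltW // ltNge; apply/negP => H; apply: NL; right; split => //.
  rewrite big_nat_recr //=; move: Fl; rewrite /F /big_claim /= in_itv /= andbT => Cl.
  have H1 : p * tau l.+1 w <= p * tl l by rewrite ler_pM2l.
  have H2 : p * tl l = p / nu + p * A + l%:R * (p / nu).
    by rewrite /tl -natr1; ring.
  have H3 : cl l = u + (p / nu + p * A + A') + (l%:R * (p / nu) - l%:R * b).
    by rewrite /cl /D /s; ring.
  by lra.
apply: le_trans Hsum; rewrite -(ler_pM2l s0) mulrCA mulrA deE.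
have clE : cl 0%N = u + D by rewrite /cl mul0r addr0.
rewrite clE in HM; have := fsum_ge M; rewrite -/Phi clE => H1.
have Gp := G0 (u + D).
have H2 : m * ((1 - de) * G (u + D)) <= s * Phi.
  by apply: le_trans H1; rewrite ler_pM2l //; lra.
have H3 : (1 - 3 * de) * (m * ((1 - de) * G (u + D))) <= (1 - 3 * de) * (s * Phi).
  by apply: ler_wpM2l H2; lra.
have -> : s * ((1 - 3 * de) * Phi) = (1 - 3 * de) * (s * Phi) by ring.
apply: le_trans H3.
have H5 : 0 <= (1 - 5 * de) * m by rewrite mulr_ge0 ?ltW //; lra.
apply: (le_trans (ler_wpM2l H5 Hu2)).
have H6 : (1 - 5 * de) * (1 + de) <= (1 - 3 * de) * (1 - de).
  by have := sqr_ge0 de; rewrite expr2; lra.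
have mG : 0 <= m * G (u + D) by rewrite mulr_ge0 // ltW.
by have := ler_wpM2r mG H6; lra.
Qed.

End ruin_lower.

(** * Ruin happens at arrival times *)

Section ruin_event.
Context {R : realType} {d : measure_display} {T : measurableType d}.
Variables (P : probability T R) (C tau : nat -> {RV P >-> R}) (N : R -> T -> nat).
Variable p : R.
Hypothesis p0 : 0 < p.
Hypothesis tau0 : forall w, tau 0%N w = 0.
Hypothesis tauS : forall n w, tau n w < tau n.+1 w.
Hypothesis NE : forall (t : R) w n, 0 <= t -> ((n <= N t w)%N <-> tau n w <= t).

Lemma arrival_ge0 n w : 0 <= tau n w.
Proof. by elim: n => [|n IH]; [rewrite tau0 | rewrite (le_trans IH) // ltW]. Qed.

Lemma counting_arrival n w : N (tau n w) w = n.
Proof.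
have tn := arrival_ge0 n w; apply/eqP; rewrite eqn_leq; apply/andP; split.
  rewrite -ltnS ltnNge; apply/negP => /(NE w n.+1 tn).
  by rewrite leNgt tauS.
exact/(NE w n tn).
Qed.

(** Between arrivals the surplus only grows, so a nonpositive surplus at [t] was already nonpositive
    at the last arrival before [t]. The index [0] is excluded by [u > 0]. *)
Lemma ruin_eventE u : 0 < u ->
  ruin_event p u (fun i => C i : T -> R) N = \bigcup_n ruin_by C tau p u n.
Proof.
move=> u0; apply/seteqP; split => w.
  move=> [t [t0 Ht]]; exists (N t w) => //; exists (N t w) => //=.
  move: Ht; rewrite /surplus subr_le0 big_mkord; apply: le_trans.
  by rewrite lerD2l ler_pM2l //; apply/(NE w _ (ltW t0)).
move=> [n _ [[|l] ln /= Hl]].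
  by move: Hl; rewrite tau0 mulr0 addr0 big_geq // leNgt u0.
exists (tau l.+1 w); split; first exact: le_lt_trans (arrival_ge0 l w) (tauS l w).
by rewrite /surplus counting_arrival subr_le0 -(big_mkord xpredT (fun i => C i w)).
Qed.

Lemma ruin_by_subset u : {homo ruin_by C tau p u : n k / (n <= k)%N >-> n `<=` k}.
Proof. by move=> n k nk w [l ln Hl]; exists l => //=; exact: leq_trans ln _. Qed.

Lemma pr_ruin_event_le u c : 0 < u ->
  (forall n, pr P (ruin_by C tau p u n) <= c) ->
  pr P (ruin_event p u (fun i => C i : T -> R) N) <= c.
Proof.
move=> u0 H; rewrite ruin_eventE //.
have mr n : measurable (ruin_by C tau p u n) by exact: measurable_ruin_by.
have mU : measurable (\bigcup_n ruin_by C tau p u n) by exact: bigcup_measurable.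
have cv : (P \o ruin_by C tau p u) @ \oo --> P (\bigcup_n ruin_by C tau p u n).
  by apply: nondecreasing_cvg_mu => // n k nk; apply/subsetPset; exact: ruin_by_subset.
rewrite -lee_fin -prE // -(cvg_lim _ cv) //; apply: lime_le.
  by apply/cvg_ex; exists (P (\bigcup_n ruin_by C tau p u n)).
by apply: nearW => n; rewrite /= prE // lee_fin.
Qed.

Lemma pr_ruin_event_ge u n : 0 < u ->
  pr P (ruin_by C tau p u n) <= pr P (ruin_event p u (fun i => C i : T -> R) N).
Proof.
move=> u0; rewrite ruin_eventE //; apply: pr_sub.
- exact: measurable_ruin_by.
- by apply: bigcup_measurable => k _; exact: measurable_ruin_by.
- by move=> w; exists n.
Qed.

End ruin_event.

(** * Choice of the arrival rates and of the claim drift *)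

Section ruin_rates.
Context {R : realType}.
Implicit Types (m mu p c rho nu : R).

(** The last inequality amounts to [nu < nu0 = c p / (m (1 + c))], and the hypothesis on [c] says
    [mu < nu0]; the midpoint serves. *)
Lemma upper_rate m mu p c : 0 < m -> 0 <= mu -> 0 < p ->
  mu * m / p < 1 -> mu * m / p / (1 - mu * m / p) < c ->
  exists nu, [/\ mu < nu, 0 < nu, m < p / nu & m / (p / nu - m) < c].
Proof.
move=> m0 mu0 p0; set rho := mu * m / p => rho1 rhoc.
have rho0 : 0 <= rho by rewrite divr_ge0 ?mulr_ge0 // ltW.
have c0 : 0 < c by apply: le_lt_trans rhoc; rewrite divr_ge0 // subr_ge0 ltW.
have c10 : 0 < 1 + c by lra.
pose nu0 := c * p / (m * (1 + c)).
have D0 : 0 < m * (1 + c) by rewrite mulr_gt0.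
have nu00 : 0 < nu0 by rewrite divr_gt0 // mulr_gt0.
have nu0E : nu0 * (m * (1 + c)) = c * p by rewrite divfK // gt_eqF.
have munu : mu < nu0.
  rewrite ltr_pdivlMr // mulrA.
  have -> : mu * m = rho * p by rewrite /rho divfK // gt_eqF.
  rewrite mulrAC ltr_pM2r //; move: rhoc; rewrite ltr_pdivrMr ?subr_gt0 //.
  by move=> ?; lra.
pose nu := (mu + nu0) / 2.
have nu0' : 0 < nu by rewrite /nu; lra.
have nunu : nu < nu0 by rewrite /nu; lra.
have key : nu * (m * (1 + c)) < c * p by rewrite -nu0E ltr_pM2r.
have mnu : m * nu < p.
  rewrite -(ltr_pM2l c0) (le_lt_trans _ key) //.
  have : 0 <= nu * m by rewrite mulr_ge0 // ltW.
  by lra.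
have mp : m < p / nu by rewrite ltr_pdivlMr.
exists nu; split => //; first by rewrite /nu; lra.
rewrite ltr_pdivrMr ?subr_gt0 // mulrBr ltrBrDr mulrA ltr_pdivlMr //.
by lra.
Qed.

(** With [a = p / mu], the hypothesis leaves a gap between [a - m] and [m / c]. Raising [a] and
    lowering [m] by at most a third of it each keeps [p / nu - b] below [m / c]; the cap [m / 2]
    keeps [b] positive. *)
Lemma lower_rate m mu p c : 0 < m -> 0 <= mu -> 0 < p ->
  mu * m / p < 1 -> 0 < c -> c < mu * m / p / (1 - mu * m / p) ->
  exists nu b, [/\ 0 < nu, nu < mu, 0 < b, b < m & b < p / nu /\ c < m / (p / nu - b)].
Proof.
move=> m0 mu0 p0; set rho := mu * m / p => rho1 c0 crho.
have mup : 0 < mu.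
  rewrite lt_neqAle mu0 andbT; apply/eqP => mu00.
  by move: crho; rewrite /rho -mu00 !mul0r ltNge ltW.
pose a := p / mu; have a0 : 0 < a by rewrite divr_gt0.
have rhoE : rho = m / a by rewrite /rho /a; field; rewrite !gt_eqF.
have ma : m < a by move: rho1; rewrite rhoE ltr_pdivrMr // mul1r.
have cam : c * (a - m) < m.
  move: crho; have -> : rho / (1 - rho) = m / (a - m).
    by rewrite rhoE; field; rewrite ?gt_eqF ?subr_gt0.
  by rewrite ltr_pdivlMr // subr_gt0.
pose gap := m / c - (a - m).
have gap0 : 0 < gap by rewrite subr_gt0 ltr_pdivlMr // mulrC.
pose g := Num.min (gap / 3) (m / 2).
have g0 : 0 < g by rewrite lt_min !divr_gt0.
have gg : g <= gap / 3 by rewrite ge_min lexx.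
have gm : g <= m / 2 by rewrite ge_min lexx orbT.
pose al := a + gap / 3; have al0 : 0 < al by rewrite addr_gt0 // divr_gt0.
have pal : p / (p / al) = al by field; rewrite !gt_eqF.
exists (p / al), (m - g); rewrite pal; split; try lra.
- by rewrite divr_gt0.
- rewrite ltr_pdivrMr // /al mulrDr /a [mu * (_ / _)]mulrC divfK ?gt_eqF //.
  by rewrite ltrDl mulr_gt0 // divr_gt0.
- have alb : m - g < al by rewrite /al; lra.
  split => //; rewrite ltr_pdivlMr ?subr_gt0 // mulrC -ltr_pdivlMr //.
  rewrite /al; have : m / c = gap + (a - m) by rewrite /gap; ring.
  by move=> ->; lra.
Qed.

End ruin_rates.

(** * The two bounds combined into the limit of the ratio *)

Theorem theorem1 (R : realType) (d : measure_display) (T : measurableType d)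
  (P : probability T R) (p : R) (B : R -> R) (C : nat -> {RV P >-> R})
  (tau : nat -> {RV P >-> R}) (N : R -> T -> nat) (mu : R) (I : R -> \bar R) :
  0 < p ->
  (* claims: nonnegative, identically distributed with d.f. B, finite mean *)
  (forall i w, 0 <= C i w) ->
  (forall i x, P [set w | C i w <= x] = (B x)%:E) ->
  ('E_P[C 0%N] < +oo)%E ->
  (* claims i.i.d. and independent of the point process *)
  claims_indep P (fun i => C i : T -> R) (fun j => tau j : T -> R) ->
  (* simple point process: tau_0 = 0 < tau_1 < tau_2 < ..., N_t = #{i >= 1 : tau_i <= t} *)
  (forall w, tau 0%N w = 0) ->
  (forall n w, tau n w < tau n.+1 w) ->
  (forall t w n, 0 <= t -> ((n <= N t w)%N <-> tau n w <= t)) ->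
  (* Assumption A1 *)
  LDP P (fun t w => (N t w)%:R / t) I ->
  (forall x, I x = 0%E <-> x = mu) ->
  (forall x y, mu <= x -> x <= y -> (I x <= I y)%E) ->
  (forall x y, 0 <= x -> x <= y -> y <= mu -> (I y <= I x)%E) ->
  mu * fine 'E_P[C 0%N] / p < 1 ->
  (exists2 theta : R, 0 < theta & forall n : nat,
     (\int[P]_w (expR (theta * \sum_(1 <= i < n.+1) (tau i w - tau i.-1 w)))%:E
       < +oo)%E) ->
  (* B_0 subexponential *)
  subexponential (integrated_tail (fine 'E_P[C 0%N]) B) ->
  let rho := mu * fine 'E_P[C 0%N] / p in
  (fine (P (ruin_event p u (fun i => C i : T -> R) N))
     / (1 - integrated_tail (fine 'E_P[C 0%N]) B u))
    @[u --> +oo] --> (rho / (1 - rho) : R).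
Proof.
move=> p0 C0 CB _ ind tau0 tauS NE ldp I0 Iinc Idec rho1 _ Bsub rho.
move: rho1 Bsub @rho; set m := fine _ => rho1 Bsub rho.
have Blim : integrated_tail m B @ +oo --> (1 : R) by case: Bsub => -[_ [_ [_ ?]]] _.
(* For [m = 0] the inverse is [0] by convention, so the integrated tail vanishes identically and
   cannot tend to [1]. *)
have m_neq0 : m != 0.
  apply/eqP => m00; move/cvgrPdist_lt : Blim => /(_ 1 ltr01) [x [_ /(_ (x + 1))]].
  by rewrite ltrDl /integrated_tail m00 invr0 mul0r subr0 normr1 ltxx => /(_ ltr01).
have m0 : 0 < m by rewrite lt_neqAle eq_sym m_neq0 fine_ge0 // expectation_ge0.
have Bnd x y : x <= y -> B x <= B y by exact: claim_df_le CB x y.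
have B0 x : 0 <= B x by exact: claim_df_ge0 CB x.
have B1 x : B x <= 1 by exact: claim_df_le1 CB x.
pose G x := 1 - integrated_tail m B x.
have Gtail : subexponential_tail G.
  by apply: subexponentialP => //; exact: integrated_tail0.
have GE x y : m * (G x - G y) = m * (integrated_tail m B y - integrated_tail m B x).
  by rewrite /G; ring.
have BG x y : 0 <= x -> x <= y -> (y - x) * (1 - B y) <= m * (G x - G y).
  move=> x0 xy; rewrite GE.
  by have /andP[] := integrated_tail_bounds Bnd B0 B1 m_neq0 x0 xy.
have GB x y : 0 <= x -> x <= y -> m * (G x - G y) <= (y - x) * (1 - B x).
  move=> x0 xy; rewrite GE.
  by have /andP[] := integrated_tail_bounds Bnd B0 B1 m_neq0 x0 xy.
have Gy e : 0 < e -> exists x0, forall x, x0 <= x -> G x <= e.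
  move=> e0; move/cvgrPdist_le : Blim => /(_ e e0) [x0 [_ H]].
  exists (x0 + 1) => x xx; rewrite (le_trans (ler_norm _)) // H //.
  by rewrite (lt_le_trans _ xx) // ltrDl.
have mu0 : 0 <= mu := ldp_mean_ge0 ldp I0.
have [_ _ G0 _ _] := Gtail.
apply/cvgrPdist_le => e e0.
have [nu [munu nu0 mnu nuc]] : exists nu, [/\ mu < nu, 0 < nu, m < p / nu &
    m / (p / nu - m) < rho / (1 - rho) + e].
  by apply: upper_rate => //; rewrite ltrDl.
have [u1 H1] := ruin_by_le ind (arrival_ge0 tau0 tauS) CB m0 Gtail BG p0 nu0
  (arrival_early NE ldp I0 Iinc munu) mnu nuc.
have [u2 H2] : exists u2, forall u, u2 <= u -> 0 < u -> (rho / (1 - rho) - e) * G u <=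
    pr P (ruin_event p u (fun i => C i : T -> R) N).
  (* A nonpositive constant makes the lower bound trivial; otherwise it is admissible for
     [lower_rate]. *)
  have [c0|c0] := leP (rho / (1 - rho) - e) 0.
    exists 0 => u _ _; apply: le_trans (pr_ge0 _ _).
    by rewrite mulr_le0_ge0 // ltW.
  have [al [b [al0 almu b0 bm [bal cal]]]] : exists nu b, [/\ 0 < nu, nu < mu,
      0 < b, b < m & b < p / nu /\ rho / (1 - rho) - e < m / (p / nu - b)].
    by apply: lower_rate => //; rewrite gtrBl.
  have [u2 H2] := ruin_by_ge ind C0 CB m0 Gtail BG GB Gy p0 al0 b0 bm
    (arrival_late NE ldp I0 Idec (ltW al0) almu) bal c0 cal.
  exists u2 => u /H2[n Hn] u0; apply: (le_trans Hn).
  exact: pr_ruin_event_ge.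
exists (Num.max (Num.max u1 u2) 0); split; first exact: num_real.
move=> u.
rewrite gt_max gt_max => /andP[/andP[/ltW uu1 /ltW uu2] u0] /=.
rewrite -/(G u) -/(pr P _) distrC ler_distl; apply/andP; split.
  by rewrite ler_pdivlMr // H2.
rewrite ler_pdivrMr //; apply: (pr_ruin_event_le p0 tau0 tauS NE u0) => n.
exact: H1.
Qed.
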